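(* Let $\{X_n : n\ge 0\}$ be vertex-reinforced random walk (VRRW) on $\mathbb{Z}$ started at a fixed vertex $v\in\mathbb{Z}$, with augmented occupation numbers $Z(n,x)$, and let $R'=\{j\in\mathbb{Z} : X_n=j \text{ for infinitely many } n\}$. For any closed interval $I\subseteq(0,1)$ of positive length and any integer $k$, with positive probability there is a (random) $\alpha\in I$ such that the following six events all occur: (i) $R'=\{k-2,k-1,k,k+1,k+2\}$; (ii) $\log Z(n,k+2)/\log n\to\alpha$ as $n\to\infty$; (iii) $\log Z(n,k-2)/\log n\to 1-\alpha$ as $n\to\infty$; (iv) $Z(n,k+1)/n\to \alpha/2$ as $n\to\infty$; (v) $Z(n,k-1)/n\to(1-\alpha)/2$ as $n\to\infty$; (vi) $Z(n,k)/n\to 1/2$ as $n\to\infty$.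
   Context: $\mathbb{Z}$ is viewed as a graph with $x\sim y$ iff $|x-y|=1$. For a process $X_0,X_1,\ldots$ with values in $\mathbb{Z}$, the augmented occupation numbers are $Z(n,x)=1+\sum_{i=0}^n \mathbf{1}_{X_i=x}$ for $x\in\mathbb{Z}$, $n\ge0$. Let $\mathcal{F}_n=\sigma(X_0,\ldots,X_n)$. Vertex-reinforced random walk (VRRW) on $\mathbb{Z}$ with starting point $v$ is the process with $X_0=v$ and $$\mathbf{P}(X_{n+1}=x\mid \mathcal{F}_n)=\mathbf{1}_{x\sim X_n}\,\frac{Z(n,x)}{\sum_{w\sim X_n}Z(n,w)}.$$ *)

(* Defs.v *)
From HB Require Import structures.
From mathcomp Require Import all_boot all_order all_algebra.
From mathcomp Require Import all_classical all_reals all_analysis.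

Set Implicit Arguments.
Unset Strict Implicit.
Unset Printing Implicit Defensive.

Import Order.TTheory GRing.Theory Num.Theory.
Import numFieldNormedType.Exports.

Local Open Scope classical_set_scope.
Local Open Scope ring_scope.

HB.instance Definition _ := isPointed.Build int 0.

HB.instance Definition _ := @isMeasurable.Build default_measure_display
  int discrete_measurable discrete_measurable0
  discrete_measurableC discrete_measurableU.

Definition int_adj (x y : int) : bool := `|x - y| == 1.

Definition occupation (T : Type) (X : nat -> T -> int) (n : nat) (x : int)
    (w : T) : nat :=
  (1 + \sum_(i < n.+1) (X i w == x))%N.

Definition infinitely_visited (T : Type) (X : nat -> T -> int) (w : T) :
    set int :=
  [set j | infinite_set [set n | X n w = j]].

Definition natural_filtration (T : Type) (X : nat -> T -> int) (n : nat) :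
    set (set T) :=
  g_sigma_preimage (fun i : 'I_n.+1 => X i).

(* [q] is a version of the conditional probability of the event [E] given the
   sub-sigma-algebra [F]. *)
Definition is_cond_prob (d : measure_display) (T : measurableType d)
    (R : realType) (P : probability T R) (F : set (set T)) (E : set T)
    (q : T -> R) : Prop :=
  preimage_set_system setT q measurable `<=` F /\
  forall A : set T, F A -> P (A `&` E) = (\int[P]_(w in A) (q w)%:E)%E.

(* The sum over the neighbours of [X n w] is a sum over a finite subset of the
   infinite type [int], hence the use of [\sum_(_ \in _)] from [fsbigop]. *)
Definition vrrw_step (R : realType) (T : Type) (X : nat -> T -> int) (n : nat)
    (x : int) (w : T) : R :=
  (int_adj x (X n w))%:R *
  ((occupation X n x w)%:R /
   \sum_(y \in [set y | int_adj y (X n w)]) ((occupation X n y w)%:R : R)).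

Definition is_vrrw (d : measure_display) (T : measurableType d)
    (R : realType) (P : probability T R) (v : int) (X : nat -> {RV P >-> int}) :
    Prop :=
  {ae P, forall w, X 0%N w = v} /\
  forall (n : nat) (x : int),
    is_cond_prob P (natural_filtration X n) [set w | X n.+1 w = x]
      (vrrw_step R X n x).

(* Main.v *)
Require Import Defs.
From HB Require Import structures.
From mathcomp Require Import all_boot all_order all_algebra.
From mathcomp Require Import ring lra zify.
From mathcomp Require Import all_classical all_reals all_analysis.

Set Implicit Arguments.
Unset Strict Implicit.
Unset Printing Implicit Defensive.

Import Order.TTheory GRing.Theory Num.Theory.
Import numFieldNormedType.Exports.

Local Open Scope classical_set_scope.
Local Open Scope ring_scope.

(* Centre the window at 0. The urn at 0 draws 1 or -1 with probability
   proportional to the occupation numbers, so the sum of +- 1/Z over its draws is a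
   martingale with increments of variance 1/(Z(1)Z(-1)). It equals log (Z(1)/Z(-1))
   up to the sum of 1/Z(1) over returns from 2, its analogue for -2, and a
   convergent error. Each of the following is controlled by a nonnegative function
   of the history that is a supermartingale while the walk is well behaved: the
   oscillations of this martingale, the sums of 1/Z(+-1) over the visits to +-2
   (which bound the probability of ever reaching +-3), and the ratio of Z(+-2) to
   exp of the sum of 1/(Z(0)+Z(+-2)) over the departures from +-1. Their sum [pot]
   stays below 1 forever with probability at least 1 minus its initial value, and
   long oscillations between 1, 0 and -1 make this initial value small with
   Z(1)/Z(-1) in any prescribed range. On that event everything else is
   deterministic: Z(1)/Z(-1) converges, Z(+-2) = o(n), and a weighted Cesaro
   argument turns the exponent of Z(+-2) into alpha log n and (1-alpha) log n. *)

(** * Limits of real sequences *)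

Section Sequences.
Variable R : realType.
Implicit Types (u t h c w : R^nat) (l C al : R).

Lemma eq_near_cvg u w l : (\forall n \near \oo, u n = w n) ->
  w n @[n --> \oo] --> l -> u n @[n --> \oo] --> l.
Proof.
move=> uw; apply: cvg_trans; apply: near_eq_cvg.
by apply: filterS uw => n ->.
Qed.

Lemma cvg0_div_infty u t C : (\forall n \near \oo, `|u n| <= C) ->
  t n @[n --> \oo] --> +oo -> u n / t n @[n --> \oo] --> 0.
Proof.
move=> uC /cvgryPge tp; apply/cvgr0Pnorm_le => e e0.
near=> n.
have t1 : 1 <= t n by near: n; exact: tp.
have t0 : 0 < t n by apply: lt_le_trans t1.
rewrite normrM normfV (gtr0_norm t0) ler_pdivrMr//.
have : C / e <= t n by near: n; exact: tp.
rewrite ler_pdivrMr// mulrC; apply: le_trans.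
by near: n.
Unshelve. all: by end_near. Qed.

Lemma cvg_ln_pinfty t : t n @[n --> \oo] --> +oo -> ln (t n) @[n --> \oo] --> +oo.
Proof.
move=> /cvgryPge tp; apply/cvgryPge => A; have := tp (expR A).
apply: filterS => n tn; rewrite -[A]expRK ler_ln ?posrE ?expR_gt0//.
exact: lt_le_trans (expR_gt0 _) tn.
Qed.

(** The Stolz-Cesaro argument: once [c] stays within [e / 2] of [al], [|u - al * h|] grows by at
    most [e / 2] times the increment of [h], and its value at that rank is negligible since [h]
    diverges. *)
Lemma weighted_cesaro u h c al :
  (forall n, h n <= h n.+1) -> h n @[n --> \oo] --> +oo ->
  c n @[n --> \oo] --> al ->
  (forall n, u n.+1 - u n = c n * (h n.+1 - h n)) ->
  u n / h n @[n --> \oo] --> al.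
Proof.
move=> hS /cvgryPge hoo cal uS; apply/cvgrPdist_le => e e0.
have e2 : 0 < e / 2 by rewrite divr_gt0.
have [N _ cN] : \forall n \near \oo, `|al - c n| <= e / 2.
  by move/cvgrPdist_le : cal; exact.
pose K := `|u N - al * h N|.
have bnd m : `|u (N + m)%N - al * h (N + m)%N| <= e / 2 * (h (N + m)%N - h N) + K.
  elim: m => [|m IH]; first by rewrite addn0 subrr mulr0 add0r.
  rewrite addnS; set n := (N + m)%N in IH *.
  have -> : u n.+1 - al * h n.+1 =
      (u n - al * h n) + (c n - al) * (h n.+1 - h n).
    by have := uS n; rewrite mulrBl => <-; ring.
  apply: le_trans (ler_normD _ _) _.
  have hn : 0 <= h n.+1 - h n by rewrite subr_ge0.
  rewrite normrM (ger0_norm hn).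
  have := ler_wpM2r hn (cN n (leq_addr m N)); rewrite distrC.
  by move: IH; rewrite -/n; lra.
near=> n.
have Nn : (N <= n)%N by near: n; exact: nbhs_infty_ge.
have h1 : 1 <= h n by near: n; exact: hoo.
have h2 : (K + e / 2 * `|h N|) / (e / 2) <= h n by near: n; exact: hoo.
have h0 : 0 < h n by apply: lt_le_trans h1.
have -> : al - u n / h n = - (u n - al * h n) / h n by field; rewrite gt_eqF.
rewrite normrM normfV (gtr0_norm h0) normrN ler_pdivrMr//.
have := bnd (n - N)%N; rewrite subnKC// => /le_trans; apply.
move: h2; rewrite ler_pdivrMr//; have := ler_norm (- h N); rewrite normrN => hN.
have := ler_wpM2l (ltW e2) hN; lra.
Unshelve. all: by end_near. Qed.

(** Beyond [J], two values of [u] differ by at most the square root of [l / w J], which tends to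
    0. *)
Lemma weighted_cauchy u w l :
  (forall J n m, (J <= n)%N -> (J <= m)%N -> w J * (u n - u m) ^+ 2 <= l) ->
  w n @[n --> \oo] --> +oo -> cvgn u.
Proof.
move=> uw /cvgryPge woo; apply/cauchy_cvgP; apply: cauchy_exP => e e0.
have [J _ wJ] := woo ((`|l| + 1) / e ^+ 2).
exists (u J); exists J => // n /= Jn; rewrite /ball /= distrC.
have e2 : 0 < e ^+ 2 by rewrite exprn_gt0.
have w0 : 0 < w J.
  by apply: lt_le_trans (wJ J (leqnn J)); rewrite divr_gt0// ltr_wpDl.
rewrite -ltr_sqr ?nnegrE ?(ltW e0)// real_normK ?num_real//.
rewrite -(ltr_pM2l w0); apply: (le_lt_trans (uw _ _ _ Jn (leqnn J))).
have := wJ J (leqnn J); rewrite ler_pdivrMr//; apply: lt_le_trans.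
by rewrite ltr_pwDr// ler_norm.
Qed.

(** * Exponent of an outer vertex from the visits to its inner neighbour *)

Section Logarithmic.
Variables (z1 z2 t c rt hd : R^nat) (bt al C : R).
Hypotheses (t_oo : t n @[n --> \oo] --> +oo) (bt_gt0 : 0 < bt).
Hypothesis z1_gt0 : forall n, 0 < z1 n.
Hypothesis z1_t : z1 n / t n @[n --> \oo] --> bt.
Hypothesis hd_z1 : forall n, `|hd n.+1 - ln (z1 n)| <= C.
Hypothesis rt_z2 : forall n, `|ln (z2 n) - rt n.+1| <= C.

Let lnt_oo : ln (t n) @[n --> \oo] --> +oo.
Proof. exact: cvg_ln_pinfty. Qed.

Let t_gt0 : \forall n \near \oo, 0 < t n.
Proof. by move/cvgryPgt : t_oo; exact. Qed.

Let lnt_gt0 : \forall n \near \oo, 0 < ln (t n).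
Proof. by move/cvgryPgt : lnt_oo; exact. Qed.

Lemma ln_z1_t : ln (z1 n) / ln (t n) @[n --> \oo] --> (1 : R).
Proof.
have H : ln (z1 n / t n) / ln (t n) + 1 @[n --> \oo] --> (0 + 1 : R).
  apply: cvgD; last exact: cvg_cst.
  rewrite -(mulr0 (ln bt)); apply: cvgM.
    by apply: continuous_cvg z1_t; exact: continuous_ln.
  by apply/gtr0_cvgV0.
rewrite add0r in H; apply: eq_near_cvg H; near=> n.
have t0 : 0 < t n by near: n.
have l0 : 0 < ln (t n) by near: n.
by rewrite ln_div ?posrE// mulrBl divff ?gt_eqF// subrK.
Unshelve. all: by end_near. Qed.

Lemma hd_lnt : hd n.+1 / ln (t n) @[n --> \oo] --> (1 : R).
Proof.
have H : (hd n.+1 - ln (z1 n)) / ln (t n) @[n --> \oo] --> (0 : R).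
  by apply: (cvg0_div_infty (C := C)) lnt_oo; exact: nearW.
have {}H : (hd n.+1 - ln (z1 n)) / ln (t n) + ln (z1 n) / ln (t n) @[n --> \oo]
    --> (0 + 1 : R) by apply: cvgD => //; exact: ln_z1_t.
rewrite add0r in H; apply: eq_near_cvg H.
by apply: nearW => n; rewrite /= mulrBl subrK.
Qed.

Lemma hd_oo : hd n @[n --> \oo] --> +oo.
Proof.
have z1oo : ln (z1 n) @[n --> \oo] --> +oo.
  apply/cvgryPge => A; have /cvgrPdist_le/(_ (2^-1))H := ln_z1_t.
  have half : 0 < 2^-1 :> R by [].
  near=> n.
  have H1 : `|1 - ln (z1 n) / ln (t n)| <= 2^-1 by near: n; exact: H half.
  have l0 : 0 < ln (t n) by near: n.
  have lA : 2 * A <= ln (t n) by near: n; move/cvgryPge : lnt_oo; exact.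
  have : 2^-1 <= ln (z1 n) / ln (t n) by move/ler_normlP : H1 => [_]; lra.
  rewrite ler_pdivlMr//; lra.
rewrite -cvg_shiftS; apply/cvgryPge => A; move/cvgryPge : z1oo => /(_ (A + C)).
by apply: filterS => n; have /ler_normlP[] := hd_z1 n; rewrite /=; lra.
Unshelve. all: by end_near. Qed.

Hypothesis c_al : c n @[n --> \oo] --> al.
Hypothesis hd_nd : forall n, hd n <= hd n.+1.
Hypothesis rt_hd : forall n, rt n.+1 - rt n = c n * (hd n.+1 - hd n).

(** The increments of [rt] are those of [hd] weighted by [c], so [rt / hd] tends to [al]; and [hd]
    is equivalent to [ln t] because [z1] is of order [t]. *)
Lemma ln_z2_t : ln (z2 n) / ln (t n) @[n --> \oo] --> al.
Proof.
have H1 := weighted_cesaro hd_nd hd_oo c_al rt_hd.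
have H2 : rt n.+1 / hd n.+1 @[n --> \oo] --> al.
  by rewrite (cvg_shiftS (fun n => rt n / hd n)).
have H3 : rt n.+1 / hd n.+1 * (hd n.+1 / ln (t n)) @[n --> \oo] --> al * 1.
  by apply: cvgM => //; exact: hd_lnt.
have H4 : (ln (z2 n) - rt n.+1) / ln (t n) @[n --> \oo] --> (0 : R).
  by apply: (cvg0_div_infty (C := C)) lnt_oo; exact: nearW.
have {}H4 : (ln (z2 n) - rt n.+1) / ln (t n) +
    rt n.+1 / hd n.+1 * (hd n.+1 / ln (t n)) @[n --> \oo] --> 0 + al * 1.
  by apply: cvgD.
rewrite add0r mulr1 in H4; apply: eq_near_cvg H4.
have hd0 : \forall n \near \oo, 0 < hd n.+1.
  by have := hd_oo; rewrite -cvg_shiftS => /cvgryPgt; exact.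
near=> n; have h0 : 0 < hd n.+1 by near: n.
by rewrite /= mulrA mulfVK ?gt_eqF// mulrBl subrK.
Unshelve. all: by end_near. Qed.

End Logarithmic.

Lemma sublinear_power (z2 t : R^nat) (th C : R) :
  th < 1 -> t n @[n --> \oo] --> +oo ->
  (forall n, 0 < z2 n) ->
  (\forall n \near \oo, ln (z2 n) <= th * ln (t n) + C) ->
  z2 n / t n @[n --> \oo] --> 0.
Proof.
move=> th1 too z20 z2t; apply/cvgr0Pnorm_le => e e0.
have lnt := cvg_ln_pinfty too.
have th10 : 0 < 1 - th by lra.
near=> n.
have t0 : 0 < t n by near: n; move/cvgryPgt : too; exact.
rewrite gtr0_norm ?divr_gt0// -ler_ln ?posrE ?divr_gt0// ln_div ?posrE//.
have : (C - ln e) / (1 - th) <= ln (t n) by near: n; move/cvgryPge : lnt; exact.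
rewrite ler_pdivrMr//.
have : ln (z2 n) <= th * ln (t n) + C by near: n.
by lra.
Unshelve. all: by end_near. Qed.

End Sequences.

(** * The potential *)

(* A history is the list of the positions of the walk, most recent first. *)
Definition occ (h : seq int) (x : int) : nat := (1 + count_mem x h)%N.

Definition cur (h : seq int) : int := head 0 h.

Definition sg (b : bool) : int := if b then 1 else -1.

(** The conditional mean of [z2] after a draw is [z2 * (1 + 1 / (z0 + z2))], and
    [1 + x <= expR x]. *)
Lemma growth_step (R : realType) (z0 z2 A : R) : 0 < z0 -> 0 < z2 ->
  z0 / (z0 + z2) * (z2 * expR (- (A + (z0 + z2)^-1))) +
  z2 / (z0 + z2) * ((z2 + 1) * expR (- (A + (z0 + z2)^-1))) <=
  z2 * expR (- A).
Proof.
move=> z0_gt0 z2_gt0; have S0 : 0 < z0 + z2 by exact: addr_gt0.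
rewrite opprD expRD.
have : (1 + (z0 + z2)^-1) * expR (- (z0 + z2)^-1) <= 1.
  by rewrite expRN ler_pdivrMr ?expR_gt0// mul1r expR_ge1Dx.
move/(ler_wpM2l (ltW (mulr_gt0 z2_gt0 (expR_gt0 (- A))))); rewrite mulr1.
apply: le_trans; rewrite le_eqVlt; apply/orP; left; apply/eqP.
by field; rewrite lt0r_neq0.
Qed.

(** Shifting by 1 gives a closed form: the reciprocal of [z2 - 1] has conditional mean
    [(1 - 1 / (z0 + z2)) / (z2 - 1)], and [1 - x <= expR (- x)]. *)
Lemma decay_step (R : realType) (z0 z2 A : R) : 0 < z0 -> 1 < z2 ->
  z0 / (z0 + z2) * (expR (A + (z0 + z2)^-1) / (z2 - 1)) +
  z2 / (z0 + z2) * (expR (A + (z0 + z2)^-1) / (z2 + 1 - 1)) <=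
  expR A / (z2 - 1).
Proof.
move=> z0_gt0 z2_gt1; have z2_gt0 : 0 < z2 by rewrite (lt_trans _ z2_gt1).
have S0 : 0 < z0 + z2 by exact: addr_gt0.
have z2B : 0 < z2 - 1 by rewrite subr_gt0.
rewrite expRD addrK.
have : (1 - (z0 + z2)^-1) * expR ((z0 + z2)^-1) <= 1.
  rewrite -[X in X * _]opprK -[expR _]invrK -expRN ler_pdivrMr ?expR_gt0// mul1r.
  by rewrite opprK expR_ge1Dx.
move/(ler_wpM2l (ltW (divr_gt0 (expR_gt0 A) z2B))); rewrite mulr1.
apply: le_trans; rewrite le_eqVlt; apply/orP; left; apply/eqP.
by field; rewrite !lt0r_neq0.
Qed.

(** [D] counts departures from the inner vertex. With the toll [c / (D + 1)] charged on reaching the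
    outer one, the numerator grows on average by the factor [1 + (1 + g) / (z0 + z2)], at most the
    factor [1 + 1 / D] gained by the denominator. *)
Lemma drift_step (R : realType) (z0 z2 D g c : R) :
  0 < z0 -> 0 < z2 -> 0 < D -> 0 < g -> 0 < c -> (1 + g) * D <= z0 + z2 ->
  z0 / (z0 + z2) * (c / g * z2 / (D + 1)) +
  z2 / (z0 + z2) * (c / g * (z2 + 1) / (D + 1) + c / (D + 1)) <=
  c / g * z2 / D.
Proof.
move=> z0_gt0 z2_gt0 D0 g0 c0 gD; have S0 : 0 < z0 + z2 by exact: addr_gt0.
have D1 : 0 < D + 1 by exact: addr_gt0.
have : 1 + (1 + g) / (z0 + z2) <= 1 + D^-1.
  by rewrite lerD2l ler_pdivrMr// mulrC ler_pdivlMr.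
have P : 0 < c / g * z2 / (D + 1) by rewrite !(mulr_gt0, invr_gt0).
move/(ler_wpM2l (ltW P)).
have -> : c / g * z2 / (D + 1) * (1 + D^-1) = c / g * z2 / D.
  by field; rewrite !lt0r_neq0.
apply: le_trans; rewrite le_eqVlt; apply/orP; left; apply/eqP.
by field; rewrite !lt0r_neq0.
Qed.

(** * Harmonic sums and the logarithm *)

Definition harm (R : realType) (n : nat) : R := \sum_(i < n) i.+1%:R^-1.

Lemma harmS (R : realType) n : harm R n.+1 = harm R n + n.+1%:R^-1.
Proof. by rewrite /harm big_ord_recr. Qed.

Lemma ln_ratio_lb (R : realType) (n : nat) :
  n.+2%:R^-1 <= ln (n.+2%:R : R) - ln n.+1%:R.
Proof.
have n1 : 0 < n.+1%:R :> R by [].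
have n2 : 0 < n.+2%:R :> R by [].
rewrite -(ler_expR) expRB !lnK ?posrE//.
rewrite -[leLHS]invrK -expRN -[leRHS]invrK.
rewrite lef_pV2 ?posrE ?invr_gt0 ?divr_gt0 ?expR_gt0//.
rewrite invf_div; apply: le_trans (expR_ge1Dx _).
by rewrite ler_pdivrMr// mulrBl mul1r mulVf ?gt_eqF// -[n.+2]addn1 natrD addrK.
Qed.

Lemma ln_ratio_ub (R : realType) (n : nat) :
  ln (n.+2%:R : R) - ln n.+1%:R <= n.+1%:R^-1.
Proof.
have n1 : 0 < n.+1%:R :> R by [].
have n2 : 0 < n.+2%:R :> R by [].
rewrite -(ler_expR) expRB !lnK ?posrE//; apply: le_trans (expR_ge1Dx _).
by rewrite -[n.+2]addn1 natrD mulrDl divff ?gt_eqF// mul1r.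
Qed.

Lemma harm_ln_nd (R : realType) :
  {homo (fun n => harm R n - ln n.+1%:R) : m n / (m <= n)%N >-> m <= n}.
Proof.
apply: homo_leq => [x//|y x w /le_trans xy yw|n]; first exact: xy.
rewrite /= harmS; have := ln_ratio_ub R n.
by move: (ln _) (ln _) (harm R n) _^-1 => x y u v; lra.
Qed.

(** With [harm_ln_nd], this squeezes the variation of [harm R n - ln n.+1%:R] beyond any index [m]
    between 0 and [m.+1%:R^-1]. *)
Lemma harm_ln_ni (R : realType) :
  {homo (fun n => harm R n - ln n.+1%:R + n.+1%:R^-1) :
    m n / (m <= n)%N >-> n <= m}.
Proof.
apply: homo_leq => [x//|y x w xy yw|n]; first exact: le_trans yw xy.
rewrite /= harmS; have := ln_ratio_lb R n.
by move: (ln _) (ln _) (harm R n) n.+1%:R^-1 n.+2%:R^-1 => x y u v w; lra.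
Qed.

Lemma harm_ge_ln (R : realType) n : ln n.+1%:R <= harm R n.
Proof.
have := @harm_ln_nd R 0 n (leq0n n).
by by rewrite /harm big_ord0 ln1 subr0 subr_ge0.
Qed.

Lemma harm_le_ln (R : realType) n : harm R n <= 1 + ln n.+1%:R.
Proof.
have := @harm_ln_ni R 0 n (leq0n n).
rewrite /harm big_ord0 ln1 invr1; have : 0 < n.+1%:R^-1 :> R by rewrite invr_gt0.
by move: (ln _) (\sum_(_ < n) _) _^-1 => x y u; lra.
Qed.

Lemma neighbours (p x y : int) : x + y = p *+ 2 -> `|x - p| = 1 ->
  (x = p - 1 /\ y = p + 1) \/ (x = p + 1 /\ y = p - 1).
Proof. by lia. Qed.

Section Potential.
Variables (R : realType) (h0 : seq int).
Implicit Types (s : seq int) (x y : int) (b : bool).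

(* In this section the window is centred at 0, [h0] is a fixed initial history
   and [s] lists the positions visited after it. *)
Definition pos s : int := cur (s ++ h0).

Definition z s x : R := (occ (s ++ h0) x)%:R.

(* Up to an additive constant, the number of departures from [x]: it stays put
   while the walk sits at [x] and is updated when it leaves. *)
Definition dep s x : R := z s x - (pos s == x)%:R.

(* The urn at 0 draws a neighbour with probability proportional to its occupation
   number, so this sum of [+-] inverse occupation numbers is a martingale; it is
   the logarithm of the ratio of the occupation numbers of 1 and -1, up to the
   corrections [ret] and a bounded convergent error. *)
Fixpoint urn s : R :=
  if s is y :: s' then
    urn s' + (if pos s' == 0 then
                (if y == 1 then (z s' 1)^-1 else - (z s' (- 1))^-1) else 0)
  else 0.

(* Returns from [2 sg b] also increase the occupation number of [sg b]. *)
Fixpoint ret b s : R :=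
  if s is _ :: s' then
    ret b s' + (if pos s' == sg b *+ 2 then (z s' (sg b))^-1 else 0)
  else 0.

(* The compensator of the logarithm of the occupation number of [2 sg b]. *)
Fixpoint rate b s : R :=
  if s is _ :: s' then
    rate b s' +
    (if pos s' == sg b then (z s' 0 + z s' (sg b *+ 2))^-1 else 0)
  else 0.

Variable w0 : R.

(** The coefficient of [t ^+ 2] in [osc s t]. *)
Fixpoint wgt s : R :=
  if s is _ :: s' then wgt s' + (if pos s' == 0 then (dep s' 0)^-1 else 0)
  else w0.

(* Applied to [t = urn s], this is a weighted sum, over all past visits to 0, of
   the squared increments of [urn] since that visit. The weights [1 / dep] have a
   divergent sum, so that its boundedness makes [urn] a Cauchy sequence, while
   their products with the variances of the remaining increments are summable. *)
Fixpoint osc s (t : R) : R :=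
  if s is _ :: s' then
    osc s' t + (if pos s' == 0 then (t - urn s') ^+ 2 / dep s' 0 else 0)
  else w0 * t ^+ 2.

Variables (lam L g c2 ct : R).

(* Its three groups of terms control the occupation number of [2 sg b] from above
   and below by [expR (rate b s)], and the sum [ret b s], which also dominates the
   probability of ever stepping to [3 sg b]. *)
Definition side b s : R :=
  z s (sg b *+ 2) * expR (- rate b s) / lam +
  expR (rate b s) / (z s (sg b *+ 2) - 1) / lam +
  (L * ret b s + c2 / g * z s (sg b *+ 2) / dep s (sg b) +
   c2 / dep s (sg b) * (pos s == sg b *+ 2)%:R).

(** The second term is designed to drop, at each departure from 0, by at least the expected increase
    of [osc s (urn s)]. *)
Definition centre s : R := osc s (urn s) + ct * (wgt s + 2) / (dep s 0 - 1).

(* A step to [3] or [-3] makes the potential at least 1. *)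
Definition pot s : R :=
  side true s + side false s + centre s + (`|pos s| == 3)%:R.

Lemma zS y s x : z (y :: s) x = z s x + (y == x)%:R.
Proof. by rewrite /z /occ /= addnCA natrD addrC. Qed.

Lemma depS y s x : dep (y :: s) x = z s x.
Proof. by rewrite /dep zS addrK. Qed.

Lemma z_dep s x : z s x = dep s x + (pos s == x)%:R.
Proof. by rewrite subrK. Qed.

Lemma posS y s : pos (y :: s) = y.
Proof. by []. Qed.

Lemma z_ge1 s x : 1 <= z s x.
Proof. by rewrite ler1n. Qed.

Lemma z_gt0 s x : 0 < z s x.
Proof. exact: lt_le_trans (z_ge1 s x). Qed.

Lemma z_nil_le s x : z [::] x <= z s x.
Proof.
by elim: s => //= y s IH; rewrite zS (le_trans IH)// lerDl.
Qed.

Lemma dep_nil_le s x : dep [::] x <= dep s x.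
Proof.
elim: s => //= y s IH; rewrite depS (le_trans IH)// z_dep lerDl.
by [].
Qed.

Lemma ret_ge0 b s : 0 <= ret b s.
Proof.
elim: s => //= y s IH; rewrite addr_ge0//; case: ifP => // _.
by rewrite invr_ge0 ltW// z_gt0.
Qed.

Hypothesis dep0 : 2 <= dep [::] 0.
Hypothesis w0_gt0 : 0 < w0.

Lemma dep0_ge2 s : 2 <= dep s 0.
Proof. exact: le_trans (dep_nil_le s 0). Qed.

Lemma wgt_gt0 s : 0 < wgt s.
Proof.
elim: s => //= y s IH; rewrite ltr_wpDr//; case: ifP => // _.
by rewrite invr_ge0 (le_trans _ (dep0_ge2 s)).
Qed.

(** This allows an exact one-step mean in [centre_origin] and the extraction of a Cauchy bound in
    [urn_cvg]. *)
Lemma osc_quad s : exists B C : R, forall t, osc s t = wgt s * t ^+ 2 + B * t + C.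
Proof.
elim: s => [|y s [B [C IH]]] /=.
  by exists 0, 0 => t; rewrite mul0r !addr0.
case: ifP => _; last by exists B, C => t; rewrite !addr0.
exists (B - 2 * urn s / dep s 0), (C + urn s ^+ 2 / dep s 0) => t.
by rewrite IH; ring.
Qed.

Lemma osc_ge0 s t : 0 <= osc s t.
Proof.
elim: s => /= [|y s IH]; first by rewrite mulr_ge0 ?sqr_ge0// ltW.
rewrite addr_ge0//; case: ifP => // _.
by rewrite mulr_ge0 ?sqr_ge0// invr_ge0 (le_trans _ (dep0_ge2 s)).
Qed.

Hypotheses (lam_gt0 : 0 < lam) (L_gt0 : 0 < L) (g_gt0 : 0 < g) (ct_gt0 : 0 < ct).
Hypothesis c2_gt0 : 0 < c2.
Hypothesis z2_ge2 : forall b, 2 <= z [::] (sg b *+ 2).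
Hypothesis dep1_ge1 : forall b, 1 <= dep [::] (sg b).

Lemma dep1_gt0 b s : 0 < dep s (sg b).
Proof.
by rewrite (lt_le_trans _ (dep_nil_le s _))// (lt_le_trans _ (dep1_ge1 b)).
Qed.

Lemma z2B1_gt0 b s : 0 < z s (sg b *+ 2) - 1.
Proof. have := le_trans (z2_ge2 b) (z_nil_le s _); lra. Qed.

Lemma side_ge0 b s : 0 <= side b s.
Proof.
have z2 := z_gt0 s (sg b *+ 2); have z21 := z2B1_gt0 b s.
have d1 := dep1_gt0 b s; have r := ret_ge0 b s.
have e1 := expR_gt0 (rate b s); have e2 := expR_gt0 (- rate b s).
rewrite /side.
by do ?[exact: r | exact: ltW | exact: ler0n | apply: addr_ge0 | apply: mulr_ge0
  | rewrite invr_ge0].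
Qed.

Lemma centre_ge0 s : 0 <= centre s.
Proof.
have d0 := dep0_ge2 s; have w := wgt_gt0 s.
rewrite /centre addr_ge0 ?osc_ge0// mulr_ge0 ?invr_ge0//; last by lra.
by apply: mulr_ge0; [exact: ltW | lra].
Qed.

Lemma pot_ge0 s : 0 <= pot s.
Proof.
have h1 := side_ge0 true s; have h2 := side_ge0 false s.
have h3 := centre_ge0 s; have h4 : 0 <= (`|pos s| == 3)%:R :> R by [].
by rewrite /pot; lra.
Qed.

(** [growth_step], [decay_step] and [drift_step] apply term by term; [ret b] is unchanged, since
    only departures from [sg b *+ 2] feed it. *)
Lemma side_inner b s : pos s = sg b ->
  (1 + g) * dep s (sg b) <= z s 0 + z s (sg b *+ 2) ->
  z s 0 / (z s 0 + z s (sg b *+ 2)) * side b (0 :: s) +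
  z s (sg b *+ 2) / (z s 0 + z s (sg b *+ 2)) * side b (sg b *+ 2 :: s) <=
  side b s.
Proof.
move=> ps gD.
have z0 := z_gt0 s 0; have z2 := z_gt0 s (sg b *+ 2); have d1 := dep1_gt0 b s.
have S0 : 0 < z s 0 + z s (sg b *+ 2) by exact: addr_gt0.
have pq : z s 0 / (z s 0 + z s (sg b *+ 2)) +
    z s (sg b *+ 2) / (z s 0 + z s (sg b *+ 2)) = 1.
  by rewrite -mulrDl divff ?gt_eqF.
have z2_gt1 : 1 < z s (sg b *+ 2) by rewrite -subr_gt0 z2B1_gt0.
rewrite /side !depS !zS !posS /= ps.
have [-> -> -> ->] : [/\ (0 == sg b *+ 2) = false, (sg b == sg b) = true,
  (sg b *+ 2 == sg b *+ 2) = true & (sg b == sg b *+ 2) = false] by case: (b).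
rewrite (z_dep s (sg b)) ps eqxx !addr0 !mulr0 !addr0 /= !mulr1n !mulr1.
have lamV : 0 <= lam^-1 by rewrite invr_ge0 ltW.
have H1 := ler_wpM2r lamV (growth_step (rate b s) z0 z2).
have H2 := ler_wpM2r lamV (decay_step (rate b s) z0 z2_gt1).
have H3 := drift_step z0 z2 d1 g_gt0 c2_gt0 gD.
have H4 : (z s 0 / (z s 0 + z s (sg b *+ 2)) +
    z s (sg b *+ 2) / (z s 0 + z s (sg b *+ 2))) * (L * ret b s) <= L * ret b s.
  by rewrite pq mul1r.
have := lerD (lerD H1 H2) (lerD H4 H3).
apply: le_trans; rewrite le_eqVlt; apply/orP; left; apply/eqP.
by ring.
Qed.

Variable K : R.
Hypothesis LK : L + K <= c2.

(** Leaving [sg b *+ 2] releases the toll [c2 / z s (sg b)]. It pays [L / z s (sg b)] for the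
    increase of [L * ret b s] and at most [K / z s (sg b)] for the chance of a step to [sg b *+ 3],
    whose extra 1 is the last term of [pot]. *)
Lemma side_outer b s : pos s = sg b *+ 2 -> z s (sg b *+ 3) <= K ->
  z s (sg b) / (z s (sg b) + z s (sg b *+ 3)) * side b (sg b :: s) +
  z s (sg b *+ 3) / (z s (sg b) + z s (sg b *+ 3)) *
    (side b (sg b *+ 3 :: s) + 1) <= side b s.
Proof.
move=> ps z3K.
have z1 := z_gt0 s (sg b); have z3 := z_gt0 s (sg b *+ 3).
have S0 : 0 < z s (sg b) + z s (sg b *+ 3) by exact: addr_gt0.
have pq : z s (sg b) / (z s (sg b) + z s (sg b *+ 3)) =
    1 - z s (sg b *+ 3) / (z s (sg b) + z s (sg b *+ 3)).
  by field; rewrite gt_eqF.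
have dz : dep s (sg b) = z s (sg b).
  by rewrite z_dep ps; case: (b); rewrite addr0.
have E y : (y == sg b *+ 2) = false ->
    side b (y :: s) = side b s + (L - c2) / z s (sg b).
  move=> y2; rewrite /side !depS !zS !posS /= ps y2 dz eqxx.
  have -> : (sg b *+ 2 == sg b) = false by case: (b).
  by rewrite !addr0 !mulr0 /= !mulr1n; ring.
rewrite !E; [|by case: (b)..].
rewrite pq; set q := _ / _.
have qK : q <= K / z s (sg b).
  apply: ler_pM; rewrite ?invr_ge0 ?(ltW z3) ?(ltW S0)//.
  by rewrite lef_pV2 ?posrE// lerDl ltW.
have : L / z s (sg b) + K / z s (sg b) <= c2 / z s (sg b).
  by rewrite -mulrDl ler_pM2r ?invr_gt0.
by rewrite mulrBl; lra.
Qed.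

Lemma side_far b s y : pos s != sg b -> pos s != sg b *+ 2 -> y != sg b *+ 2 ->
  side b (y :: s) = side b s.
Proof.
move=> /negbTE p1 /negbTE p2 /negbTE y2.
by rewrite /side !depS !zS !posS /= y2 p1 p2 !addr0 (z_dep s (sg b)) p1 addr0.
Qed.

Lemma centre_far s y : pos s != 0 -> centre (y :: s) = centre s.
Proof.
move=> /negbTE p0.
by rewrite /centre depS /= p0 !addr0 (z_dep s 0) p0 addr0.
Qed.

(** The increment of [urn] has mean 0 and variance [1 / (z s 1 * z s (-1))], so [osc] gains on
    average this variance times the new weight. The hypothesis bounds the variance by
    [ct / dep s 0 ^+ 2]. *)
Lemma centre_origin s : pos s = 0 ->
  dep s 0 ^+ 2 <= ct * (z s 1 * z s (-1)) ->
  z s (-1) / (z s (-1) + z s 1) * centre (-1 :: s) +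
  z s 1 / (z s (-1) + z s 1) * centre (1 :: s) <= centre s.
Proof.
move=> p0 dct.
have z1 := z_gt0 s 1; have zm1 := z_gt0 s (-1).
have d2 := dep0_ge2 s; have w := wgt_gt0 s.
have S0 : 0 < z s (-1) + z s 1 by exact: addr_gt0.
have [B [C oq]] := osc_quad s.
rewrite /centre !depS /= p0 !eqxx /= (z_dep s 0) p0 eqxx !oq /= !mulr1n.
set d := dep s 0 in d2 dct *; set u := urn s; set v := z s 1 in z1 S0 dct *.
set v' := z s (-1) in zm1 S0 dct *; set W := wgt s in w *.
have d0 : 0 < d by lra.
have d1 : 0 < d - 1 by lra.
(* The drop of the second term of [centre]. The 2 added to the weight absorbs its own growth by
   [d^-1], which is at most 1. *)
have K1 : ct * (W + d^-1) / d ^+ 2 <= ct * (W + 2) / (d - 1) -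
    ct * (W + d^-1 + 2) / (d + 1 - 1).
  have -> : ct * (W + 2) / (d - 1) - ct * (W + d^-1 + 2) / (d + 1 - 1) =
     ct * (W + 1) / d ^+ 2 + ct * (W + 2) / (d ^+ 2 * (d - 1)).
    by field; rewrite ?addrK !lt0r_neq0.
  have dV : d^-1 <= 1 by rewrite invf_le1//; lra.
  rewrite -[leLHS]addr0 lerD//; last first.
    apply: mulr_ge0; first by apply: mulr_ge0; [exact: ltW|lra].
    by rewrite invr_ge0 mulr_ge0 ?sqr_ge0// ltW.
  rewrite ler_wpM2r ?invr_ge0 ?sqr_ge0// ler_wpM2l ?(ltW ct_gt0)//.
  by rewrite lerD2l.
have K2 : (W + d^-1) / (v * v') <= ct * (W + d^-1) / d ^+ 2.
  rewrite ler_pdivrMr ?mulr_gt0// mulrAC ler_pdivlMr ?exprn_gt0//.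
  rewrite -[leRHS]mulrA mulrC [leRHS]mulrCA [leRHS]mulrC mulrC -mulrA.
  rewrite [_ * (W + _)]mulrC.
  have Wd : 0 < W + d^-1 by rewrite addr_gt0 ?invr_gt0.
  rewrite -(ler_pM2l Wd) in dct.
  by apply: le_trans dct _; rewrite le_eqVlt; apply/orP; left; apply/eqP; ring.
have -> : v' / (v' + v) * (W * (u - v'^-1) ^+ 2 + B * (u - v'^-1) + C +
     (u - v'^-1 - u) ^+ 2 / d + ct * (W + d^-1 + 2) / (d + 1 - 1)) +
   v / (v' + v) * (W * (u + v^-1) ^+ 2 + B * (u + v^-1) + C +
     (u + v^-1 - u) ^+ 2 / d + ct * (W + d^-1 + 2) / (d + 1 - 1)) =
   W * u ^+ 2 + B * u + C + (W + d^-1) / (v * v') +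
   ct * (W + d^-1 + 2) / (d + 1 - 1).
  by field; rewrite ?addrK !lt0r_neq0.
by move: K1 K2; lra.
Qed.

(** * Deterministic consequences of a small potential *)

Definition hrm s x : R := harm R (count_mem x (s ++ h0)).

(** Since [occ] starts at 1, arrivals are weighted as in [urn] and [ret]. *)
Lemma hrmS y s x : hrm (y :: s) x = hrm s x + (if y == x then (z s x)^-1 else 0).
Proof.
rewrite /hrm /= eq_sym eq_sym; case: eqP => _; last by rewrite add0n addr0.
by rewrite add1n harmS.
Qed.

Fixpoint good s : Prop :=
  if s is y :: s' then
    [/\ good s', (y == pos s' - 1) || (y == pos s' + 1) & pot s < 1]
  else pot [::] < 1.

Hypothesis pos0 : pos [::] = 0.

Lemma good_pot s : good s -> pot s < 1.
Proof. by case: s => // y s []. Qed.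

(** A nearest-neighbour path from 0 leaves the window through 3 or -3, where the potential is at
    least 1. *)
Lemma good_pos s : good s -> pos s \in [:: 0; 1; -1; 2; -2].
Proof.
elim: s => [_|y s IH [gs ys]]; first by rewrite pos0.
have s1 := side_ge0 true (y :: s); have s2 := side_ge0 false (y :: s).
have s3 := centre_ge0 (y :: s).
rewrite /pot posS => p1; have {p1 s1 s2 s3} : `|y| != 3.
  by apply/eqP => y3; move: p1; rewrite y3 eqxx /=; lra.
move: (IH gs) ys; rewrite !inE.
move=> /or4P[/eqP->|/eqP->|/eqP->|/orP[/eqP->|/eqP->]] /orP[/eqP->|/eqP->];
  by [].
Qed.

Lemma good_step y s : good (y :: s) ->
  (pos s, y) \in [:: (0, 1); (0, -1); (1, 0); (1, 2); (-1, 0); (-1, -2);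
    (2, 1); (-2, -1)].
Proof.
move=> gys; have := good_pos gys; rewrite posS; case: gys => /good_pos.
rewrite !inE => /or4P[/eqP->|/eqP->|/eqP->|/orP[/eqP->|/eqP->]]
  /orP[/eqP->|/eqP->] _; by [].
Qed.

Lemma good_ind (P : seq int -> Prop) :
  P [::] ->
  (forall y s, good (y :: s) -> P s ->
    (pos s, y) \in [:: (0, 1); (0, -1); (1, 0); (1, 2); (-1, 0); (-1, -2);
    (2, 1); (-2, -1)] -> P (y :: s)) ->
  forall s, good s -> P s.
Proof.
move=> P0 PS; elim => // y s IH gys; apply: PS => //; last exact: good_step.
by apply: IH; case: gys.
Qed.

Ltac step_cases := rewrite !inE =>
  /or4P[|||/orP[|/or4P[]]] => /eqP[ps ->].

Lemma good_z3 b s : good s -> z s (sg b *+ 3) = z [::] (sg b *+ 3).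
Proof.
move: s; apply: good_ind => // y s _ IH; step_cases; rewrite zS IH; case: (b);
  by rewrite addr0.
Qed.

(** An arrival at 1 comes from 0, and enters [urn], or from 2, and enters [ret true]; the same holds
    at -1 with opposite signs. *)
Lemma good_hrm s : good s ->
  hrm s 1 - hrm s (-1) - (hrm [::] 1 - hrm [::] (-1)) =
  urn s + ret true s - ret false s.
Proof.
move: s; apply: good_ind => [|y s _ IH]; first by rewrite /=; lra.
by step_cases; rewrite /= ps !hrmS /= ?addr0; lra.
Qed.

(** The walk alternates between even and odd vertices: each departure from 1 or -1 is an arrival at
    0, 2 or -2. *)
Lemma good_bal s : good s ->
  z s 0 + z s 2 + z s (-2) - dep s 1 - dep s (-1) =
  z [::] 0 + z [::] 2 + z [::] (-2) - z [::] 1 - z [::] (-1).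
Proof.
move: s; apply: good_ind => [|y s _ IH].
  by rewrite !z_dep pos0 !addr0.
by step_cases; rewrite !zS !depS -IH !(z_dep s 1, z_dep s (-1)) ps /=; lra.
Qed.

Lemma good_sum s : good s ->
  z s 0 + z s 1 + z s (-1) + z s 2 + z s (-2) =
  z [::] 0 + z [::] 1 + z [::] (-1) + z [::] 2 + z [::] (-2) + (size s)%:R.
Proof.
move: s; apply: good_ind => [|y s _ IH]; first by rewrite addr0.
rewrite [size _]/= -[(size s).+1]addn1 natrD addrA -IH.
by step_cases; rewrite !zS /=; lra.
Qed.

Lemma osc_lb s t : w0 * t ^+ 2 <= osc s t.
Proof.
elim: s => //= y s IH; rewrite (le_trans IH)// lerDl; case: ifP => // _.
by rewrite mulr_ge0 ?sqr_ge0// invr_ge0 (le_trans _ (dep0_ge2 s)).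
Qed.

Lemma good_side b s : good s -> side b s < 1.
Proof.
move=> /good_pot; have h1 := side_ge0 true s; have h2 := side_ge0 false s.
have h3 := centre_ge0 s; have h4 : 0 <= (`|pos s| == 3)%:R :> R by [].
by rewrite /pot; case: (b); lra.
Qed.

Lemma good_osc s : good s -> osc s (urn s) < 1.
Proof.
move=> /good_pot; have h1 := side_ge0 true s; have h2 := side_ge0 false s.
have h4 : 0 <= (`|pos s| == 3)%:R :> R by [].
have d0 := dep0_ge2 s; have w := wgt_gt0 s.
have h3 : 0 <= ct * (wgt s + 2) / (dep s 0 - 1).
  by apply: mulr_ge0; [apply: mulr_ge0; [exact: ltW|lra]|rewrite invr_ge0; lra].
by rewrite /pot /centre; lra.
Qed.

Lemma good_side_parts b s : good s ->
  [/\ z s (sg b *+ 2) * expR (- rate b s) < lam,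
      expR (rate b s) < lam * (z s (sg b *+ 2) - 1),
      L * ret b s <= 1 &
      c2 / g * z s (sg b *+ 2) <= dep s (sg b)].
Proof.
move=> /(good_side b).
have z2 := z_gt0 s (sg b *+ 2); have z21 := z2B1_gt0 b s.
have d1 := dep1_gt0 b s; have r := ret_ge0 b s.
have e1 := expR_gt0 (rate b s); have e2 := expR_gt0 (- rate b s).
rewrite /side; set t1 := _ / lam; set t2 := _ / lam; set t3 := L * _.
set t4 := _ / dep _ _; set t5 := _ / _ * _%:R.
have p1 : 0 <= t1 by rewrite divr_ge0 ?(ltW lam_gt0)// mulr_ge0// ltW.
have p2 : 0 <= t2.
  by rewrite divr_ge0 ?(ltW lam_gt0)// divr_ge0// ltW.
have p3 : 0 <= t3 by rewrite mulr_ge0// ltW.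
have p4 : 0 <= t4.
  by rewrite divr_ge0 ?(ltW d1)// mulr_ge0 ?(ltW z2)// divr_ge0// ltW.
have p5 : 0 <= t5 by rewrite mulr_ge0// divr_ge0// ltW.
move=> lt1; split.
- have : t1 < 1 by lra.
  by rewrite /t1 ltr_pdivrMr// mul1r.
- have : t2 < 1 by lra.
  by rewrite /t2 ltr_pdivrMr// mul1r ltr_pdivrMr.
- by lra.
- have : t4 <= 1 by lra.
  by rewrite /t4 ler_pdivrMr// mul1r.
Qed.

(** [lo] and [hi] are bounds for the ratio of the occupation numbers of 1 and -1, [eps] is the
    margin of its initial logarithm, and [r0] bounds both the ratio and its inverse from below. *)
Variables (lo hi eps r0 : R).
Hypotheses (lo_gt0 : 0 < lo) (hi_gt0 : 0 < hi) (eps_gt0 : 0 < eps).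
Hypotheses (r0_gt0 : 0 < r0) (r0_lo : r0 <= lo) (r0_hi : r0 * hi <= 1).
Hypothesis ratio_lo : ln lo + eps <= ln (z [::] 1) - ln (z [::] (-1)).
Hypothesis ratio_hi : ln (z [::] 1) - ln (z [::] (-1)) <= ln hi - eps.
Hypothesis w0_eps : 1 <= w0 * (eps / 4) ^+ 2.
Hypothesis L_eps : L^-1 <= eps / 4.
Hypothesis z1_eps : forall b, (z [::] (sg b))^-1 <= eps / 4.
Hypothesis g_r0 : g = r0 / 4.
Hypothesis c2_g : 4 <= c2 / g.
Hypothesis ct_r0 : 4 * (1 + r0^-1) ^+ 2 <= ct.
Hypothesis z3_K : forall b, z [::] (sg b *+ 3) <= K.
Hypothesis bal_K :
  `|z [::] 0 + z [::] 2 + z [::] (-2) - z [::] 1 - z [::] (-1)| <= K.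
Hypothesis dep_K : forall b, 4 * K <= dep [::] (sg b).

Lemma good_urn s : good s -> `|urn s| <= eps / 4.
Proof.
move=> /good_osc h1; have h2 := osc_lb s (urn s).
rewrite -ler_sqr ?nnegrE ?divr_ge0 ?(ltW eps_gt0)// real_normK ?num_real//.
rewrite -(ler_pM2l w0_gt0).
exact: le_trans h2 (le_trans (ltW h1) w0_eps).
Qed.

Lemma hrm_ln s x :
  0 <= (hrm s x - ln (z s x)) - (hrm [::] x - ln (z [::] x)) <= (z [::] x)^-1.
Proof.
have cnt : (count_mem x ([::] ++ h0) <= count_mem x (s ++ h0))%N.
  by rewrite cat0s count_cat leq_addl.
have h1 := harm_ln_nd R cnt; have h2 := harm_ln_ni R cnt.
have : 0 <= (count_mem x (s ++ h0)).+1%:R^-1 :> R by rewrite invr_ge0.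
move: h1 h2; rewrite /hrm /z /occ !add1n /=; set a := harm R _; set b := harm R _.
move: (ln _) (ln _) (_^-1) (_^-1) => u v w t; lra.
Qed.

(** In [good_hrm], [urn], the difference of the two sums [ret] and the difference of the two errors
    of [hrm_ln] are each at most [eps / 4] in absolute value. *)
Lemma good_ratio s : good s ->
  `|(ln (z s 1) - ln (z s (-1))) - (ln (z [::] 1) - ln (z [::] (-1)))| <= eps.
Proof.
move=> gs; have /ler_normlP[u1 u2] := good_urn gs; have H := good_hrm gs.
have rb b : 0 <= ret b s <= eps / 4.
  rewrite ret_ge0 (le_trans _ L_eps)//; have [_ _ + _] := good_side_parts b gs.
  by rewrite -[L^-1]mulr1 ler_pdivlMl.
have /andP[h1 h2] := hrm_ln s 1.
have /andP[h3 h4] := hrm_ln s (-1).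
have := z1_eps true; have := z1_eps false; have := rb true; have := rb false.
rewrite /sg; move: h1 h2 h3 h4 u1 u2 H.
move: (ln _) (ln _) (ln _) (ln _) => a1 a2 a3 a4.
move: (z [::] 1)^-1 (z [::] (-1))^-1 => a5 a6.
move: (hrm s 1) (hrm s (-1)) (hrm [::] 1) (hrm [::] (-1)) (ret _ s) (ret _ s).
by move=> *; apply/ler_normlP; split; lra.
Qed.

Lemma good_lo s : good s -> lo * z s (-1) <= z s 1.
Proof.
move=> gs; have /ler_normlP[h1 h2] := good_ratio gs.
have z1 := z_gt0 s 1; have zm1 := z_gt0 s (-1).
rewrite -ler_ln ?posrE ?mulr_gt0// lnM ?posrE//; move: ratio_lo; lra.
Qed.

Lemma good_hi s : good s -> z s 1 <= hi * z s (-1).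
Proof.
move=> gs; have /ler_normlP[h1 h2] := good_ratio gs.
have z1 := z_gt0 s 1; have zm1 := z_gt0 s (-1).
rewrite -ler_ln ?posrE ?mulr_gt0// lnM ?posrE//; move: ratio_hi; lra.
Qed.

Lemma good_r0 b s : good s -> r0 * z s (sg b) <= z s (sg (~~ b)).
Proof.
move=> gs; have z1 := z_gt0 s 1; have zm1 := z_gt0 s (-1).
case: b => /=; last first.
  by apply: le_trans (good_lo gs); rewrite ler_wpM2r// ltW.
have := ler_wpM2l (ltW r0_gt0) (good_hi gs); rewrite mulrA => /le_trans; apply.
by rewrite -[leRHS]mul1r ler_wpM2r// ltW.
Qed.

Lemma K_ge1 : 1 <= K.
Proof. exact: le_trans (z_ge1 _ _) (z3_K true). Qed.

Lemma good_z2 b s : good s -> 4 * z s (sg b *+ 2) <= dep s (sg b).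
Proof.
move=> gs; have [_ _ _] := good_side_parts b gs; apply: le_trans.
by rewrite ler_wpM2r// ltW// z_gt0.
Qed.

Lemma good_bal_b b s : good s ->
  z s 0 + z s (sg b *+ 2) + z s (sg (~~ b) *+ 2)
    - dep s (sg b) - dep s (sg (~~ b)) =
  z [::] 0 + z [::] 2 + z [::] (-2) - z [::] 1 - z [::] (-1).
Proof. by move=> /good_bal <-; case: (b) => /=; lra. Qed.

(** By [good_bal], the right side is [dep s (sg b)] plus [dep s (sg (~~ b))], less the opposite
    outer occupation number and an error [K], each at most a quarter of the latter. The remaining
    half exceeds [g * dep s (sg b)] by [good_r0]. *)
Lemma good_inner b s : good s ->
  (1 + g) * dep s (sg b) <= z s 0 + z s (sg b *+ 2).
Proof.
move=> gs; have := good_bal_b b gs; have /ler_normlP[h1 h2] := bal_K.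
have := good_z2 (~~ b) gs; have := good_r0 b gs.
have := le_trans (dep_K (~~ b)) (dep_nil_le s _).
have : r0 * dep s (sg b) <= r0 * z s (sg b).
  by rewrite ler_pM2l// z_dep lerDl.
have : z s (sg (~~ b)) <= dep s (sg (~~ b)) + 1.
  by rewrite z_dep lerD2l; case: (_ == _).
by rewrite g_r0; have := K_ge1; lra.
Qed.

(** The balance gives [dep s 0 <= 2 * (z s 1 + z s (-1))], and this sum is at most [1 + r0^-1] times
    either of its terms. *)
Lemma good_origin s : good s -> dep s 0 ^+ 2 <= ct * (z s 1 * z s (-1)).
Proof.
move=> gs; have := good_bal gs; have /ler_normlP[h1 h2] := bal_K.
have := le_trans (dep_K true) (dep_nil_le s _).
have := z_gt0 s 2; have := z_gt0 s (-2) => y1 y2 y3 y4.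
have y5 : dep s 1 <= z s 1 by rewrite z_dep lerDl.
have y6 : dep s (-1) <= z s (-1) by rewrite z_dep lerDl.
have y7 : dep s 0 <= z s 0 by rewrite z_dep lerDl.
have z1 := z_gt0 s 1; have zm1 := z_gt0 s (-1).
have d0 : 0 <= dep s 0 by have := dep0_ge2 s; lra.
have D : dep s 0 <= 2 * (z s 1 + z s (-1)) by move: y3 y4; rewrite /=; lra.
have E1 : z s 1 + z s (-1) <= (1 + r0^-1) * z s (-1).
  have := good_r0 true gs; rewrite /= -ler_pdivlMl//; lra.
have E2 : z s 1 + z s (-1) <= (1 + r0^-1) * z s 1.
  have := good_r0 false gs; rewrite /= -ler_pdivlMl//; lra.
apply: (@le_trans _ _ ((2 * (z s 1 + z s (-1))) ^+ 2)).
  by rewrite ler_sqr ?nnegrE// mulr_ge0// addr_ge0// ltW.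
apply: (@le_trans _ _ (4 * ((1 + r0^-1) * z s (-1) * ((1 + r0^-1) * z s 1)))).
  rewrite exprMn -natrX ler_pM2l// expr2 ler_pM// ltW// addr_gt0//.
rewrite [leLHS](_ : _ = 4 * (1 + r0^-1) ^+ 2 * (z s 1 * z s (-1))); last by ring.
by rewrite ler_wpM2r// mulr_ge0// ltW.
Qed.

(** * The supermartingale property *)

Definition mean_pot s : R :=
  z s (pos s - 1) / (z s (pos s - 1) + z s (pos s + 1)) * pot (pos s - 1 :: s) +
  z s (pos s + 1) / (z s (pos s - 1) + z s (pos s + 1)) * pot (pos s + 1 :: s).

Lemma mean_potE s x y : x + y = pos s *+ 2 -> `|x - pos s| = 1 ->
  let S := z s x + z s y in
  mean_pot s = z s x / S * pot (x :: s) + z s y / S * pot (y :: s).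
Proof.
move=> xy x1 S; rewrite /mean_pot /S.
by have [[-> ->]//|[-> ->]] := neighbours xy x1; rewrite addrC (addrC (z _ _)).
Qed.

(** Each departure affects one summand: [centre] at 0, and [side b] at [sg b] or [sg b *+ 2], where
    in the last case the indicator of 3 and -3 also enters. *)
Lemma mean_pot_le s : good s -> mean_pot s <= pot s.
Proof.
move=> gs; have pE := good_pos gs.
have z0 : forall x, 0 < z s x by exact: z_gt0.
have pq x y : z s x / (z s x + z s y) + z s y / (z s x + z s y) = 1.
  by rewrite -mulrDl divff ?gt_eqF ?addr_gt0.
have [p0|[b [pb|pb]]] :
    pos s = 0 \/ exists b, pos s = sg b \/ pos s = sg b *+ 2.
  move: pE; rewrite !inE => /or4P[|||/orP[]] /eqP->; first by left.
  - by right; exists true; left.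
  - by right; exists false; left.
  - by right; exists true; right.
  - by right; exists false; right.
- rewrite (@mean_potE _ (-1) 1) ?p0//.
  have := centre_origin p0 (good_origin gs).
  have := pq (-1) 1; rewrite /pot !side_far ?p0// !posS !normrN1 ?normr1 ?normr0.
  rewrite !addr0; move: (_ / _) (_ / _) => p q.
  move=> pq1; have -> : q = 1 - p by lra.
  by lra.
- rewrite (@mean_potE _ 0 (sg b *+ 2)) ?pb; [|by case: (b)..].
  have := side_inner pb (good_inner b gs).
  have := pq 0 (sg b *+ 2).
  have E y : pot (y :: s) = side b (y :: s) + side (~~ b) (y :: s) +
    centre (y :: s) + (`|y| == 3)%:R.
    by rewrite /pot posS; case: (b) => //=; rewrite [side true _ + _]addrC.
  rewrite !{}E.
  have -> : pot s = side b s + side (~~ b) s + centre s + (`|sg b| == 3)%:R.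
    by rewrite /pot pb; case: (b) => //=; rewrite [side true _ + _]addrC.
  rewrite !centre_far ?pb; [|by case: (b)..].
  rewrite !(@side_far (~~ b)) ?pb; [|by case: (b)..].
  have -> : (`|sg b *+ 2| == 3) = false by case: (b).
  have -> : (`|sg b| == 3) = false by case: (b).
  rewrite normr0 /= !addr0; move: (_ / _) (_ / _) => p q.
  move=> pq1; have -> : q = 1 - p by lra.
  by lra.
- rewrite (@mean_potE _ (sg b) (sg b *+ 3)) ?pb; [|by case: (b)..].
  have := side_outer pb; rewrite (good_z3 b gs) => /(_ (z3_K b)).
  have := pq (sg b) (sg b *+ 3); rewrite (good_z3 b gs).
  have E y : pot (y :: s) = side b (y :: s) + side (~~ b) (y :: s) +
    centre (y :: s) + (`|y| == 3)%:R.
    by rewrite /pot posS; case: (b) => //=; rewrite [side true _ + _]addrC.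
  rewrite !{}E.
  have -> : pot s = side b s + side (~~ b) s + centre s + (`|sg b *+ 2| == 3)%:R.
    by rewrite /pot pb; case: (b) => //=; rewrite [side true _ + _]addrC.
  rewrite !centre_far ?pb; [|by case: (b)..].
  rewrite !(@side_far (~~ b)) ?pb; [|by case: (b)..].
  have -> : (`|sg b *+ 2| == 3) = false by case: (b).
  have -> : (`|sg b| == 3) = false by case: (b).
  have -> : `|sg b *+ 3| == 3 by case: (b).
  rewrite /= !addr0; move: (_ / _) (_ / _) => p q.
  move=> pq1; have -> : q = 1 - p by lra.
  by lra.
Qed.

(** * Trajectories of small potential *)

Section Trajectory.
Variables (n0 : nat) (s : nat -> seq int) (y : nat -> int).
Hypothesis s0 : s 0 = [::].
Hypothesis sS : forall n, s n.+1 = y n :: s n.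
Hypothesis good_s : forall n, good (s n).

Let t n : R := (n0 + n)%:R.
Let u n : R := z (s n) 1 + z (s n) (-1).

Lemma size_traj n : size (s n) = n.
Proof. by elim: n => [|n IH]; rewrite ?s0// sS /= IH. Qed.

Lemma t_oo : t n @[n --> \oo] --> +oo.
Proof.
apply/cvgryPge => A; near=> n.
have : (`|A| <= n%:R :> R) by near: n; exact: nbhs_infty_ger.
by have := ler_norm A; rewrite /t natrD; have : 0 <= n0%:R :> R by []; lra.
Unshelve. all: by end_near. Qed.

Lemma dep_bounds x n : z (s n) x - 1 <= dep (s n) x <= z (s n) x.
Proof.
by rewrite /dep; case: (_ == _) => /=; lra.
Qed.

(** By parity, the odd vertices 1 and -1 receive half of the visits, up to a constant. *)
Lemma u_bounded : exists C : R, forall n, `|2 * u n - t n| <= C.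
Proof.
pose c := z [::] 0 + z [::] 1 + z [::] (-1) + z [::] 2 + z [::] (-2).
exists (`|c| + K + 2 + n0%:R) => n.
have := good_sum (good_s n); have := good_bal (good_s n).
rewrite size_traj -/c; have /ler_normlP[] := bal_K.
have := dep_bounds 1 n; have := dep_bounds (-1) n.
have : c <= `|c| by exact: ler_norm.
have : - c <= `|c| by rewrite -normrN ler_norm.
have : 0 <= n0%:R :> R by [].
rewrite /u /t natrD; move: (n%:R) (n0%:R) => p q *.
by apply/ler_normlP; split; lra.
Qed.

Lemma u_t : u n / t n @[n --> \oo] --> (1 / 2 : R).
Proof.
have [C uC] := u_bounded.
have H : (2 * u n - t n) / t n / 2 + 1 / 2 @[n --> \oo] --> (0 / 2 + 1 / 2 : R).
  apply: cvgD; last exact: cvg_cst.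
  apply: cvgM; last exact: cvg_cst.
  by apply: (cvg0_div_infty (C := C)) t_oo; exact: nearW.
rewrite mul0r add0r in H; apply: eq_near_cvg H.
near=> n.
have t0 : 0 < t n by near: n; move/cvgryPgt : t_oo; exact.
by move: (t n) (u n) t0 => x v x0; field; rewrite gt_eqF.
Unshelve. all: by end_near. Qed.

Lemma u_oo : u n @[n --> \oo] --> +oo.
Proof.
have [C uC] := u_bounded; apply/cvgryPge => A.
move/cvgryPge : t_oo => /(_ (2 * A + C)); apply: filterS => n.
by have /ler_normlP[] := uC n; lra.
Qed.

Lemma z2_le b n : 4 * z (s n) (sg b *+ 2) <= z (s n) (sg b).
Proof.
by have := good_z2 b (good_s n); have := dep_bounds (sg b) n; lra.
Qed.

Lemma z0_oo : z (s n) 0 @[n --> \oo] --> +oo.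
Proof.
apply/cvgryPge => A; move/cvgryPge : u_oo => /(_ (2 * (`|A| + K + 2))).
apply: filterS => n; have := good_bal (good_s n); have /ler_normlP[] := bal_K.
have := dep_bounds 1 n; have := dep_bounds (-1) n.
have : 4 * z (s n) 2 <= z (s n) 1 := z2_le true n.
have : 4 * z (s n) (-2) <= z (s n) (-1) := z2_le false n.
by have := ler_norm A; have := normr_ge0 A; have := K_ge1; rewrite /u; lra.
Qed.

Lemma traj_mono (f : seq int -> R) : (forall x r, f r <= f (x :: r)) ->
  forall J n, (J <= n)%N -> f (s J) <= f (s n).
Proof.
move=> fS; apply: (homo_leq (r := fun a b : R => a <= b)) => // [b a c|n].
  exact: le_trans.
by rewrite sS.
Qed.

Lemma osc_cons x r v : osc r v <= osc (x :: r) v.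
Proof.
rewrite /= lerDl; case: ifP => // _.
by rewrite mulr_ge0 ?sqr_ge0// invr_ge0 (le_trans _ (dep0_ge2 r)).
Qed.

(** The weight of a departure from 0 is the harmonic increment of the arrival before it, so [wgt]
    diverges with [hrm] at 0. *)
Lemma wgt_cons x r : wgt (x :: r) =
  hrm r 0 + (w0 + (dep [::] 0)^-1 - hrm [::] 0).
Proof.
elim: r x => [|x' r IH] x; first by rewrite /= pos0 eqxx; ring.
have -> : wgt (x :: x' :: r) =
    wgt (x' :: r) + (if x' == 0 then (z r 0)^-1 else 0) by rewrite -(depS x').
by rewrite IH hrmS addrAC.
Qed.

Lemma wgt_oo : wgt (s n) @[n --> \oo] --> +oo.
Proof.
rewrite -cvg_shiftS; apply/cvgryPge => A /=.
have /cvgryPge := cvg_ln_pinfty z0_oo.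
move=> /(_ (A - (w0 + (dep [::] 0)^-1 - hrm [::] 0))).
apply: filterS => n; rewrite sS wgt_cons.
have := harm_ge_ln R (count_mem 0 (s n ++ h0)).
by rewrite -[_.+1]add1n -/(z (s n) 0) -/(hrm (s n) 0); lra.
Qed.

(** As [osc] only grows with the history, the quadratic polynomial [osc (s J)] is below 1 at all
    later values of [urn]; its leading coefficient [wgt (s J)] diverges. *)
Lemma urn_cvg : cvgn (fun n => urn (s n)).
Proof.
apply: (@weighted_cauchy _ _ (fun n => wgt (s n)) 4); last exact: wgt_oo.
move=> J n m Jn Jm.
have qn : osc (s J) (urn (s n)) < 1.
  apply: le_lt_trans (good_osc (good_s n)).
  apply: (traj_mono (f := fun r => osc r (urn (s n)))) Jn => x r.
  exact: osc_cons.
have qm : osc (s J) (urn (s m)) < 1.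
  apply: le_lt_trans (good_osc (good_s m)).
  apply: (traj_mono (f := fun r => osc r (urn (s m)))) Jm => x r.
  exact: osc_cons.
have := osc_ge0 (s J) ((urn (s n) + urn (s m)) / 2); move: qn qm.
have [B [C E]] := osc_quad (s J); rewrite !E.
(* parallelogram law for the quadratic form [osc (s J)] *)
move: (wgt _) (urn _) (urn _) => W a b *; nra.
Qed.

Lemma ret_cvg b : cvgn (fun n => ret b (s n)).
Proof.
apply: nondecreasing_is_cvgn.
  move=> n m nm; apply: (traj_mono (f := ret b)) nm => x r /=.
  rewrite lerDl; case: ifP => // _; rewrite invr_ge0; exact: ltW (z_gt0 _ _).
exists (L^-1) => _ [n _ <-]; have [_ _ + _] := good_side_parts b (good_s n).
by rewrite -[L^-1]mulr1 ler_pdivlMl.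
Qed.

Lemma hrm_ln_cvg x : cvgn (fun n => hrm (s n) x - ln (z (s n) x)).
Proof.
have E r : hrm r x - ln (z r x) =
    harm R (count_mem x (r ++ h0)) - ln (count_mem x (r ++ h0)).+1%:R.
  by rewrite /hrm /z /occ add1n.
apply: nondecreasing_is_cvgn.
  move=> n m nm; apply: (traj_mono (f := fun r => hrm r x - ln (z r x))) nm => a r.
  by rewrite !E; apply: harm_ln_nd => /=; rewrite leq_addl.
exists 1 => _ [n _ <-]; rewrite E.
have := harm_le_ln R (count_mem x (s n ++ h0)).
by move: (harm _ _) (ln _) => p q; lra.
Qed.

Let lnratio n := ln (z (s n) 1) - ln (z (s n) (-1)).

Lemma lnratio_cvg : cvgn lnratio.
Proof.
have -> : lnratio = (fun n => hrm [::] 1 - hrm [::] (-1) +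
    (urn (s n) + ret true (s n) - ret false (s n)
    - (hrm (s n) 1 - ln (z (s n) 1)) + (hrm (s n) (-1) - ln (z (s n) (-1))))).
  by apply/funext => n; rewrite -good_hrm// /lnratio; ring.
apply: is_cvgD; first exact: is_cvg_cst.
apply: is_cvgD; last exact: hrm_ln_cvg.
apply: is_cvgB; last exact: hrm_ln_cvg.
apply: is_cvgB; last exact: ret_cvg.
by apply: is_cvgD; [exact: urn_cvg | exact: ret_cvg].
Qed.

(** The limiting proportion of visits to 1 among those to 1 and -1. *)
Let al : R := (1 + expR (- limn lnratio))^-1.

Lemma z1_u : z (s n) 1 / u n @[n --> \oo] --> al.
Proof.
have H : (1 + expR (- lnratio n))^-1 @[n --> \oo] --> al.
  apply: cvgV; first by rewrite gt_eqF// addr_gt0 ?expR_gt0.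
  apply: cvgD; first exact: cvg_cst.
  apply: continuous_cvg; first exact: continuous_expR.
  by apply: cvgN; exact: lnratio_cvg.
apply: eq_near_cvg H; apply: nearW => n.
have z1 := z_gt0 (s n) 1; have zm1 := z_gt0 (s n) (-1).
rewrite /lnratio opprB expRB !lnK ?posrE// /u.
by field; rewrite !gt_eqF ?addr_gt0.
Qed.

Lemma zm1_u : z (s n) (-1) / u n @[n --> \oo] --> 1 - al.
Proof.
have H : 1 - z (s n) 1 / u n @[n --> \oo] --> 1 - al.
  by apply: cvgB; [exact: cvg_cst | exact: z1_u].
apply: eq_near_cvg H; apply: nearW => n.
have z1 := z_gt0 (s n) 1; have zm1 := z_gt0 (s n) (-1).
by rewrite /u; field; rewrite gt_eqF ?addr_gt0.
Qed.

Lemma al_ge : lo / (1 + lo) <= al.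
Proof.
apply: (cvgr_to_ge z1_u); apply: nearW => n.
have z1 := z_gt0 (s n) 1; have zm1 := z_gt0 (s n) (-1).
rewrite /u ler_pdivlMr ?addr_gt0// mulrAC ler_pdivrMr ?addr_gt0//.
by have := good_lo (good_s n); lra.
Qed.

Lemma al_le : al <= hi / (1 + hi).
Proof.
apply: (cvgr_to_le z1_u); apply: nearW => n.
have z1 := z_gt0 (s n) 1; have zm1 := z_gt0 (s n) (-1).
rewrite /u ler_pdivrMr ?addr_gt0// mulrAC ler_pdivlMr ?addr_gt0//.
by have := good_hi (good_s n); lra.
Qed.

Definition share b : R := if b then al else 1 - al.

Lemma share_gt0 b : 0 < share b.
Proof.
have e0 := expR_gt0 (- limn lnratio).
case: b; rewrite /share /al; first by rewrite invr_gt0 addr_gt0.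
by rewrite subr_gt0 invf_lt1 ?addr_gt0// ltrDl.
Qed.

Lemma share_lt1 b : share b < 1.
Proof. by have := share_gt0 (~~ b); case: b => /=; lra. Qed.

Lemma z1_t b : z (s n) (sg b) / t n @[n --> \oo] --> share b / 2.
Proof.
have H : z (s n) (sg b) / u n * (u n / t n) @[n --> \oo] --> share b * (1 / 2).
  by apply: cvgM; [case: (b); [exact: z1_u | exact: zm1_u] | exact: u_t].
rewrite mul1r in H; apply: eq_near_cvg H; apply: nearW => n.
have z1 := z_gt0 (s n) 1; have zm1 := z_gt0 (s n) (-1).
by rewrite mulrA mulfVK// gt_eqF// addr_gt0.
Qed.

Lemma z1_oo b : z (s n) (sg b) @[n --> \oo] --> +oo.
Proof.
apply/cvgryPge => A; have sb := share_gt0 b.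
move/cvgrPdist_le : (@z1_t b) => /(_ (share b / 4)) H.
move/cvgryPge : t_oo => /(_ (`|A| / (share b / 4))) tA.
near=> n.
have t0 : 0 < t n by near: n; move/cvgryPgt : t_oo; exact.
have : `|share b / 2 - z (s n) (sg b) / t n| <= share b / 4.
  by near: n; apply: H; rewrite divr_gt0.
move=> /ler_normlP[_ H1].
have : share b / 4 <= z (s n) (sg b) / t n by lra.
rewrite ler_pdivlMr//; apply: le_trans.
have : `|A| / (share b / 4) <= t n by near: n.
rewrite ler_pdivrMr ?divr_gt0// mulrC; apply: le_trans; exact: ler_norm.
Unshelve. all: by end_near. Qed.

Lemma rateS b x r : rate b (x :: r) = rate b r +
  (if pos r == sg b then (z r 0 + z r (sg b *+ 2))^-1 else 0).
Proof. by []. Qed.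

(** [good_inner] compares the two sums term by term, a departure from [sg b] being matched with the
    preceding arrival. *)
Lemma rate_cons b x r : good r ->
  rate b (x :: r) <= (1 + g)^-1 * (hrm r (sg b) - hrm [::] (sg b)).
Proof.
have g1 : 0 < 1 + g by rewrite addr_gt0.
elim: r x => [|x' r IH] x gr.
  by rewrite /= pos0; case: (b) => /=; rewrite subrr mulr0 addr0.
have gr' : good r by case: gr.
rewrite rateS hrmS [_ + _ - hrm [::] _]addrAC [leRHS]mulrDr posS.
apply: (lerD (IH x' gr')).
case: eqP => [xb|_]; last by rewrite mulr0.
have := good_inner b gr; rewrite depS => H.
rewrite -invfM lef_pV2 ?posrE ?mulr_gt0 ?addr_gt0 ?z_gt0//.
Qed.

(** The first two terms of [side] keep the occupation number within a factor [lam] of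
    [expR (rate b (s n))]; the shift by one step costs at most 1. *)
Lemma z2_rate b n : `|ln (z (s n) (sg b *+ 2)) - rate b (s n.+1)| <= `|ln lam| + 1.
Proof.
have [h1 h2 _ _] := good_side_parts b (good_s n).
have z2 := z_gt0 (s n) (sg b *+ 2); have z0 := z_gt0 (s n) 0.
have H1 : ln (z (s n) (sg b *+ 2)) - rate b (s n) <= ln lam.
  rewrite -[- rate _ _]expRK -lnM ?posrE ?expR_gt0//.
  by rewrite ler_ln ?posrE ?mulr_gt0 ?expR_gt0// ltW.
have H2 : rate b (s n) - ln (z (s n) (sg b *+ 2)) <= ln lam.
  rewrite lerBlDr -lnM ?posrE// -[rate _ _]expRK.
  rewrite ler_ln ?posrE ?expR_gt0 ?mulr_gt0//.
  apply: ltW; apply: lt_trans h2 _; rewrite ltr_pM2l//; lra.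
have H3 : rate b (s n) <= rate b (s n.+1) <= rate b (s n) + 1.
  rewrite sS /= lerDl lerD2l; case: ifP => _; last by rewrite lexx ler01.
  rewrite invr_ge0 ltW ?addr_gt0//= invf_le1 ?addr_gt0//.
  by have := z_ge1 (s n) 0; lra.
have := ler_norm (ln lam); move: H1 H2 H3.
by move: (ln _) (ln _) => p q *; apply/ler_normlP; split; lra.
Qed.

(** A bootstrap: [rate_cons] yields the crude exponent [(1 + g)^-1 < 1]. The resulting sublinearity
    gives the limit at 0, needed for the exact exponent. *)
Lemma z2_t b : z (s n) (sg b *+ 2) / t n @[n --> \oo] --> (0 : R).
Proof.
have g1 : 0 < 1 + g by rewrite addr_gt0.
apply: (@sublinear_power _ _ _ (1 + g)^-1
    (`|ln lam| + 1 + (1 + g)^-1 * (1 - hrm [::] (sg b)))).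
- by rewrite invf_lt1// ltrDl.
- exact: t_oo.
- by move=> n; exact: z_gt0.
move/cvgrPdist_le : (@z1_t b) => /(_ (share b / 2)) H.
near=> n.
have t0 : 0 < t n by near: n; move/cvgryPgt : t_oo; exact.
have : `|share b / 2 - z (s n) (sg b) / t n| <= share b / 2.
  by near: n; apply: H; rewrite divr_gt0// share_gt0.
move=> /ler_normlP[H1 _]; have sb := share_lt1 b.
have : z (s n) (sg b) / t n <= 1 by lra.
rewrite ler_pdivrMr// mul1r => zt.
have lnz : ln (z (s n) (sg b)) <= ln (t n) by rewrite ler_ln ?posrE ?z_gt0.
have /ler_normlP[_ h1] := z2_rate b n.
have := rate_cons b (y n) (good_s n); rewrite -sS => h2.
have h3 : hrm (s n) (sg b) <= 1 + ln (z (s n) (sg b)).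
  by have := harm_le_ln R (count_mem (sg b) (s n ++ h0)); rewrite /z /occ add1n.
have h4 : (1 + g)^-1 * (hrm (s n) (sg b) - hrm [::] (sg b)) <=
   (1 + g)^-1 * (1 + ln (t n) - hrm [::] (sg b)).
  by rewrite ler_wpM2l ?invr_ge0 ?(ltW g1)//; lra.
by lra.
Unshelve. all: by end_near. Qed.

Lemma z0_t : z (s n) 0 / t n @[n --> \oo] --> (1 / 2 : R).
Proof.
pose e n := z (s n) 0 + z (s n) 2 + z (s n) (-2) - u n.
have [C eC] : exists C, forall n, `|e n| <= C.
  exists (K + 2) => n.
  have := good_bal (good_s n); have /ler_normlP[] := bal_K.
  have := dep_bounds 1 n; have := dep_bounds (-1) n.
  by rewrite /e /u => *; apply/ler_normlP; split; lra.
have H : u n / t n + e n / t n - z (s n) (sg true *+ 2) / t n -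
    z (s n) (sg false *+ 2) / t n @[n --> \oo] --> (1 / 2 + 0 - 0 - 0 : R).
  apply: cvgB; last exact: z2_t.
  apply: cvgB; last exact: z2_t.
  apply: cvgD; first exact: u_t.
  by apply: (cvg0_div_infty (C := C)) t_oo; exact: nearW.
rewrite !subr0 addr0 in H; apply: eq_near_cvg H; apply: nearW => n.
by rewrite /e /=; ring.
Qed.

(** The ratio [c] of the increments of [rate] to those of the harmonic sum tends to
    [(share b / 2) / (1 / 2)]. *)
Lemma ln_z2 b :
  ln (z (s n) (sg b *+ 2)) / ln (t n) @[n --> \oo] --> share b.
Proof.
pose c n := dep (s n) (sg b) / (z (s n) 0 + z (s n) (sg b *+ 2)).
have c_lim : c n @[n --> \oo] --> share b.
  have H : (z (s n) (sg b) / t n - (pos (s n) == sg b)%:R / t n) /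
     (z (s n) 0 / t n + z (s n) (sg b *+ 2) / t n) @[n --> \oo] -->
     (share b / 2 - 0) / (1 / 2 + 0).
    apply: cvgM.
      apply: cvgB; first exact: z1_t.
      apply: (cvg0_div_infty (C := 1)) t_oo; apply: nearW => n.
      by case: (_ == _); rewrite ?normr1 ?normr0.
    apply: cvgV; first by rewrite addr0 gt_eqF.
    by apply: cvgD; [exact: z0_t | exact: z2_t].
  have E : (share b / 2 - 0) / (1 / 2 + 0) = share b by field.
  rewrite E in H; apply: eq_near_cvg H; near=> n.
  have t0 : 0 < t n by near: n; move/cvgryPgt : t_oo; exact.
  rewrite /c /dep; move: (t n) t0 => x x0; field.
  by rewrite !gt_eqF ?addr_gt0 ?z_gt0 ?mulr_gt0.
(* The harmonic sum grows on arrival at [sg b] and [rate] on departure, one step later; the delay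
   [n.-1] aligns them. *)
apply: (@ln_z2_t _ (fun n => z (s n) (sg b)) _ t c (fun n => rate b (s n))
   (fun n => hrm (s n.-1) (sg b)) (share b / 2) _ (`|ln lam| + 1)) => //.
- exact: t_oo.
- by rewrite divr_gt0 ?share_gt0.
- exact: z1_t.
- move=> n /=; have := harm_le_ln R (count_mem (sg b) (s n ++ h0)).
  have := harm_ge_ln R (count_mem (sg b) (s n ++ h0)).
  rewrite -[_.+1]add1n -/(z (s n) (sg b)) -/(hrm (s n) (sg b)) => h1 h2.
  by have := normr_ge0 (ln lam) => h3; apply/ler_normlP; split; lra.
- by move=> n; exact: z2_rate.
- case=> [|n]; first by [].
  by rewrite /= sS hrmS lerDl; case: ifP => // _; rewrite invr_ge0 ltW// z_gt0.
- case=> [|n]; rewrite /= !sS /=.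
    rewrite subrr mulr0 s0 /= pos0.
    by case: (b); rewrite addr0 subrr.
  rewrite /c sS depS hrmS posS !zS /=.
  have zp := z_gt0 (s n) (sg b); rewrite [_ + _ - _ in LHS]addrC addKr.
  rewrite [_ + _ - _ in RHS]addrC addKr; case: ifP => // _; last by rewrite mulr0.
  by rewrite mulrAC (divff (lt0r_neq0 zp)) mul1r.
Unshelve. all: by end_near. Qed.

Lemma z2_oo b : z (s n) (sg b *+ 2) @[n --> \oo] --> +oo.
Proof.
apply/cvgryPge => A; have sb := share_gt0 b.
move/cvgrPdist_le : (@ln_z2 b) => /(_ (share b / 2)) H.
have lt := cvg_ln_pinfty t_oo.
near=> n.
have t0 : 0 < ln (t n) by near: n; move/cvgryPgt : lt; exact.
have : `|share b - ln (z (s n) (sg b *+ 2)) / ln (t n)| <= share b / 2.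
  by near: n; apply: H; rewrite divr_gt0.
move=> /ler_normlP[_ H1].
have : share b / 2 <= ln (z (s n) (sg b *+ 2)) / ln (t n) by lra.
rewrite ler_pdivlMr// => H2.
have : `|A| / (share b / 2) <= ln (t n) by near: n; move/cvgryPge : lt; exact.
rewrite ler_pdivrMr ?divr_gt0// mulrC => H3.
have := ln_sublinear (z_gt0 (s n) (sg b *+ 2)); have := ler_norm A.
by move: H2 H3; move: (ln _) (ln _) => p q; lra.
Unshelve. all: by end_near. Qed.

Lemma good_trajectory : exists al : R,
  [/\ lo / (1 + lo) <= al <= hi / (1 + hi),
    ln (z (s n) 2) / ln (t n) @[n --> \oo] --> al,
    ln (z (s n) (-2)) / ln (t n) @[n --> \oo] --> 1 - al,
    [/\ z (s n) 1 / t n @[n --> \oo] --> al / 2,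
        z (s n) (-1) / t n @[n --> \oo] --> (1 - al) / 2 &
        z (s n) 0 / t n @[n --> \oo] --> (1 / 2 : R)] &
    forall x, x \in [:: 0; 1; -1; 2; -2] -> z (s n) x @[n --> \oo] --> +oo].
Proof.
exists al; split.
- by rewrite al_ge al_le.
- exact: (@ln_z2 true).
- exact: (@ln_z2 false).
- by split; [exact: (@z1_t true) | exact: (@z1_t false) | exact: z0_t].
move=> x; rewrite !inE => /or4P[|||/orP[]] /eqP->.
- exact: z0_oo.
- exact: (@z1_oo true).
- exact: (@z1_oo false).
- exact: (@z2_oo true).
- exact: (@z2_oo false).
Qed.

End Trajectory.

End Potential.

(** * The law of the walk *)

Lemma int_adjP x y : int_adj y x <-> y = x - 1 \/ y = x + 1.
Proof. by rewrite /int_adj; lia. Qed.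

Lemma subr1_neq_addr1 (x : int) : x - 1 <> x + 1.
Proof. by lia. Qed.

Fixpoint walk (o : int) (h : seq int) : bool :=
  if h is y :: h' then
    if h' is [::] then y == o else int_adj y (cur h') && walk o h'
  else false.

Section Law.
Variables (d : measure_display) (T : measurableType d) (R : realType).
Variables (P : probability T R) (v : int) (X : nat -> {RV P >-> int}) (k : int).

(** Positions are recentred so that the window is centred at 0. *)
Fixpoint hist (n : nat) (w : T) : seq int :=
  if n is m.+1 then X m.+1 w - k :: hist m w else [:: X 0%N w - k].

Lemma occupation_hist n x w :
  occupation (fun i => X i) n x w = occ (hist n w) (x - k).
Proof.
rewrite /occupation /occ; congr (1 + _)%N.
elim: n => [|n IH]; rewrite big_ord_recr /=.
  by rewrite big_ord0 addn0 add0n (inj_eq (addIr _)).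
by rewrite IH addnC (inj_eq (addIr _)).
Qed.

Lemma cur_hist n w : cur (hist n w) = X n w - k.
Proof. by case: n. Qed.

Lemma measurable_X n (B : set int) : measurable (X n @^-1` B).
Proof. by apply: measurable_funPTI. Qed.

Lemma measurable_hist_eq n h : measurable [set w | hist n w = h].
Proof.
elim: n h => [|n IH] [|y h].
- by rewrite (_ : [set _ | _] = set0)//; apply/seteqP; split.
- rewrite (_ : [set _ | _] = X 0%N @^-1` [set x | [:: x - k] = y :: h])//.
  exact: measurable_X.
- by rewrite (_ : [set _ | _] = set0)//; apply/seteqP; split.
- rewrite (_ : [set _ | _] =
    X n.+1 @^-1` [set x | x - k = y] `&` [set w | hist n w = h]).
    by apply: measurableI; [exact: measurable_X | exact: IH].
  by apply/seteqP; split => w /=; [case|case=> -> ->].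
Qed.

(** There are countably many histories, so no regularity of [Q] is required. *)
Lemma measurable_hist n (Q : seq int -> Prop) : measurable [set w | Q (hist n w)].
Proof.
rewrite (_ : [set _ | _] =
    \bigcup_h (if `[< Q h >] then [set w | hist n w = h] else set0)).
  apply: countable_bigcupT_measurable; first exact: countableP.
  by move=> h; case: ifP => // _; exact: measurable_hist_eq.
apply/seteqP; split => w /=.
  by move=> Qw; exists (hist n w) => //; case: asboolP.
by case=> h _; case: asboolP => //= Qh ->.
Qed.

Lemma filtration_hist n m h : (m <= n)%N ->
  natural_filtration (fun i => X i) n [set w | hist m w = h].
Proof.
rewrite /natural_filtration /g_sigma_preimage; set G := \big[_/_]_(_ < _) _.
have GX i (B : set int) : (i <= n)%N -> @measurable _ (g_sigma_algebraType G)
    (X i @^-1` B).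
  move=> lein; apply: sub_sigma_algebra; rewrite /G.
  rewrite (bigD1 (Ordinal (lein : (i < n.+1)%N)))//=; left.
  by exists B => //; rewrite setTI.
(* The sigma-algebra of time [n] stays fixed while the induction runs over [m]. *)
change ((m <= n)%N -> @measurable _ (g_sigma_algebraType G) [set w | hist m w = h]).
elim: m h => [|m IH] [|y h] lemn.
- by rewrite (_ : [set _ | _] = set0)//; apply/seteqP; split.
- rewrite (_ : [set _ | _] = X 0%N @^-1` [set x | [:: x - k] = y :: h])//.
  exact: GX.
- by rewrite (_ : [set _ | _] = set0)//; apply/seteqP; split.
- rewrite (_ : [set _ | _] =
    X m.+1 @^-1` [set x | x - k = y] `&` [set w | hist m w = h]).
    by apply: measurableI; [exact: GX | apply: IH; exact: ltnW].
  by apply/seteqP; split => w /=; [case|case=> -> ->].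
Qed.

Definition trans (h : seq int) (y : int) : R :=
  (occ h y)%:R / ((occ h (cur h - 1))%:R + (occ h (cur h + 1))%:R).

Lemma vrrw_step_hist n y w : int_adj y (cur (hist n w)) ->
  vrrw_step R (fun i => X i) n (y + k) w = trans (hist n w) y.
Proof.
rewrite cur_hist /vrrw_step /trans => yw.
rewrite (_ : int_adj (y + k) (X n w)); last first.
  by move: yw; rewrite /int_adj opprB addrA addrAC.
rewrite mul1r !occupation_hist addrK; congr (_ / _).
rewrite (_ : [set y | int_adj y (X n w)] = [set X n w - 1; X n w + 1]).
  rewrite fsbigU//=; last first.
    by move=> z /= [-> /subr1_neq_addr1].
  by rewrite !fsbig_set1 !occupation_hist cur_hist ![_ - k + _]addrAC.
by apply/seteqP; split => z /= /int_adjP.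
Qed.

Hypothesis hX : is_vrrw v X.

(** The conditional probability is the constant [trans h y] on the event that the history is [h]. *)
Lemma hist_step n h y : size h = n.+1 -> int_adj y (cur h) ->
  P [set w | hist n.+1 w = y :: h] =
  (P [set w | hist n w = h] * (trans h y)%:E)%E.
Proof.
move=> sh yh; case: hX => _ /(_ n (y + k)) [_ /(_ [set w | hist n w = h])].
move=> /(_ (filtration_hist h (leqnn n))) E.
rewrite (_ : [set w | _] = [set w | hist n w = h] `&` [set w | X n.+1 w = y + k]).
  rewrite E.
  rewrite (@eq_integral _ _ _ P [set w | hist n w = h] (cst (trans h y)%:E)).
    by rewrite integral_cst; [rewrite muleC | exact: measurable_hist_eq].
  by move=> w; rewrite inE /= => hw; rewrite vrrw_step_hist hw.
apply/seteqP; split => w /=; first by case=> <- ->; rewrite subrK.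
by case=> -> ->; rewrite addrK.
Qed.

Lemma measure_fin_num (A : set T) : measurable A -> {p : R | P A = p%:E}.
Proof. by move=> mA; exists (fine (P A)); rewrite fineK// fin_num_measure. Qed.

(* A nonnegative function [pot] of the history that is a supermartingale as long
   as it has stayed below 1 does so forever with probability at least
   [1 - pot [::]]. *)
Section Tree.
Variables (n0 : nat) (h0 : seq int) (good : seq int -> Prop).
Variable pot : seq int -> R.
Hypothesis size_h0 : size h0 = n0.+1.
Hypothesis pot_ge0 : forall s, 0 <= pot s.
Hypothesis good_cons : forall y s, good s -> int_adj y (cur (s ++ h0)) ->
  pot (y :: s) < 1 -> good (y :: s).
Hypothesis good_behead : forall y s, good (y :: s) -> good s.
Hypothesis pot_mean : forall s, good s ->
  let c := cur (s ++ h0) in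
  trans (s ++ h0) (c - 1) * pot (c - 1 :: s) +
  trans (s ++ h0) (c + 1) * pot (c + 1 :: s) <= pot s.

Let ev s r := [set w | exists s', [/\ size s' = r,
  hist (n0 + size s + r) w = s' ++ s ++ h0 & good (s' ++ s)]].

Let measurable_ev s r : measurable (ev s r).
Proof.
exact: (measurable_hist _ (fun h => exists s', [/\ size s' = r,
  h = s' ++ s ++ h0 & good (s' ++ s)])).
Qed.

Let ev_cons y s r : ev (y :: s) r `<=` ev s r.+1.
Proof.
move=> w /= [s' [<- hs gs]]; exists (rcons s' y).
rewrite size_rcons !cat_rcons; split => //.
by rewrite -hs /= !addnS addSn.
Qed.

(** Induction on [r] over the first step: the two continuations are disjoint and [pot_mean] averages
    their bounds. A continuation with potential at least 1 has a nonpositive bound. *)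
Let ev_lb s r : good s ->
  ((1 - pot s)%:E * P [set w | hist (n0 + size s) w = s ++ h0] <= P (ev s r))%E.
Proof.
elim: r s => [|r IH] s gs.
  apply: (@le_trans _ _ (P [set w | hist (n0 + size s) w = s ++ h0])).
    by rewrite gee_pMl// ?lee_fin ?gerBl// fin_num_measure//;
      exact: measurable_hist_eq.
  apply: le_measure; rewrite ?inE//; first exact: measurable_hist_eq.
  by move=> w hs; exists [::]; split => //; rewrite addn0.
set c := cur (s ++ h0); set h := s ++ h0.
have IH' y : int_adj y c ->
    ((1 - pot (y :: s))%:E * (P [set w | hist (n0 + size s) w = h] *
      (trans h y)%:E) <= P (ev (y :: s) r))%E.
  move=> yc; rewrite -hist_step//; last by rewrite size_cat size_h0 addnS addnC.
  have [p1|p1] := ltP (pot (y :: s)) 1.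
    by have := IH _ (good_cons gs yc p1); rewrite /= addnS.
  apply: (@le_trans _ _ 0%E) => //.
  by rewrite mule_le0_ge0// lee_fin subr_le0.
have disj : ev (c - 1 :: s) r `&` ev (c + 1 :: s) r = set0.
  apply/seteqP; split => // w [/= [s1 [z1 h1 _]] [s2 [z2 h2 _]]].
  move: h2; rewrite h1 => /eqP; rewrite eqseq_cat ?z1//.
  by move=> /andP[_ /eqP[] /subr1_neq_addr1].
have : (P (ev (c - 1 :: s)%R r `|` ev (c + 1 :: s)%R r) <= P (ev s r.+1))%E.
  apply: le_measure; rewrite ?inE//; first exact: measurableU.
  by rewrite subUset; split; exact: ev_cons.
rewrite measureU//; apply: le_trans.
have cm : int_adj (c - 1) c by apply/int_adjP; left.
have cp : int_adj (c + 1) c by apply/int_adjP; right.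
apply: le_trans (leeD (IH' _ cm) (IH' _ cp)).
have [p pE] := measure_fin_num (measurable_hist_eq (n0 + size s) h).
rewrite pE.
have p0 : 0 <= p by rewrite -lee_fin -pE measure_ge0.
rewrite -!EFinM -EFinD lee_fin.
have t1 : trans h (c - 1) + trans h (c + 1) = 1.
  by rewrite /trans -mulrDl divff// gt_eqF// addr_gt0// ltr0n.
have := pot_mean gs; rewrite -/h -/c => /= H.
have : 0 <= p * (pot s - (trans h (c - 1) * pot (c - 1 :: s) +
  trans h (c + 1) * pot (c + 1 :: s))) by rewrite mulr_ge0// subr_ge0.
have -> : trans h (c + 1) = 1 - trans h (c - 1) by lra.
lra.
Qed.

(** Continuity from above along the decreasing events [ev [::] r]. *)
Lemma good_forever : good [::] ->
  ((1 - pot [::])%:E * P [set w | hist n0 w = h0] <=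
   P [set w | forall r, exists s,
     [/\ size s = r, hist (n0 + r) w = s ++ h0 & good s]])%E.
Proof.
move=> g0.
have -> : [set w | forall r, exists s,
     [/\ size s = r, hist (n0 + r) w = s ++ h0 & good s]] = \bigcap_r ev [::] r.
  apply/seteqP; split => [w H r _|w H r].
    by have [s [? ? ?]] := H r; exists s; split => //; rewrite ?cats0 ?addn0.
  by have [s [? + +]] := H r I; rewrite /= addn0 cats0 => ? ?; exists s.
have ev0 : (P (ev [::] 0%N) < +oo)%E by rewrite -ge0_fin_numE// fin_num_measure.
have mcap : measurable (\bigcap_r ev [::] r) by exact: bigcapT_measurable.
have noninc : nonincreasing_seq (ev [::]).
  apply/nonincreasing_seqP => r; apply/subsetPset => w /= [[|y s] [sr hs gs]] //.
  case: sr => sr; exists s.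
  move: gs; rewrite !cats0 => /good_behead gs; split => //.
  by move: hs; rewrite /= !addnS /= => -[].
have := nonincreasing_cvg_mu ev0 (measurable_ev [::]) mcap noninc.
apply: cvge_ge; apply: nearW => r /=.
by have := ev_lb r g0; rewrite /= addn0.
Qed.

End Tree.

Lemma hist_gt0 n h : walk (v - k) h -> size h = n.+1 ->
  (0 < P [set w | hist n w = h])%E.
Proof.
elim: n h => [|n IH] [|y [|y' h]]//.
  move=> /= /eqP-> _.
  have mX : measurable [set w | X 0%N w = v] by exact: (measurable_X 0 [set v]).
  rewrite (_ : [set _ | _] = [set w | X 0%N w = v]); last first.
    by apply/seteqP; split => w /=; [case=> /addIr|move=> ->].
  rewrite -[X in P X]setCK probability_setC; last exact: measurableC.
  have -> : P (~` [set w | X 0%N w = v]) = 0%E.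
    by case: hX => + _ => /negligibleP; apply; exact: measurableC.
  by rewrite sube0 lte01.
move=> /andP[yh wh] [sh]; rewrite hist_step//; last by rewrite /= sh.
rewrite mule_gt0 ?IH//= ?sh// lte_fin /trans divr_gt0 ?addr_gt0 ?ltr0n//.
Qed.

End Law.

(** * The initial history *)

Lemma walk_cons o y h : walk o h -> walk o (y :: h) = int_adj y (cur h).
Proof. by case: h => //= x h ->; rewrite andbT. Qed.

(** Each loop adds one visit to [c] and one to 0. *)
Definition loops (c : int) (m : nat) (h : seq int) : seq int :=
  iter m (fun h => 0 :: c :: h) h.

Lemma count_loops c m h x : count_mem x (loops c m h) =
  (m * ((0%R == x) + (c == x)) + count_mem x h)%N.
Proof. by elim: m => //= m ->; rewrite mulSn addnA addnA. Qed.

Lemma cur_loops c m h : cur h = 0 -> cur (loops c m h) = 0.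
Proof. by case: m. Qed.

Lemma walk_loops o c m h : int_adj c 0 -> cur h = 0 -> walk o h ->
  walk o (loops c m h).
Proof.
move=> c0 h0 wh; elim: m => // m IH; rewrite -[loops _ _ _]/(0 :: c :: loops c m h).
have IH' : walk o (c :: loops c m h) by rewrite walk_cons// cur_loops.
by rewrite walk_cons// /int_adj distrC.
Qed.

Lemma walk_to_origin (o : int) : exists h, walk o h /\ cur h = 0.
Proof.
have P (m : nat) : forall o, `|o|%N = m -> exists h, walk o h /\ cur h = 0.
  elim: m => [|m IH] {}o oE.
    by exists [:: 0]; move/eqP : oE; rewrite absz_eq0 => /eqP->.
  have : exists v, `|v|%N = m /\ int_adj v o.
    by rewrite /int_adj; case: (ltP o 0) => o0;
      [exists (o + 1) | exists (o - 1)]; split; lia.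
  move=> [v [vm ov]]; have [h [wh h0]] := IH _ vm.
  (* The oldest position comes last, so [rcons] prepends the starting point in time. *)
  exists (rcons h o); split; last by case: h wh h0.
  elim: h wh {h0} => //= y [|y' h] IHh /=; first by move=> /eqP->; rewrite ov eqxx.
  by move=> /andP[-> /IHh].
exact: (P _ _ erefl).
Qed.

(* Walk to the origin, visit 2 and -2 once, then oscillate: all occupation numbers
   but those of -1, 0 and 1 are bounded by a constant that depends on [o] only. *)
Lemma start_walk (R : realType) (o : int) :
  exists K : R, 1 <= K /\ forall A B N : R,
  0 < A -> A < B -> 0 < N -> exists h, let z x : R := (occ h x)%:R in
  [/\ walk o h, cur h = 0,
    [/\ N <= z 1, N <= z (-1) & N <= z 0 - 1],
    A * z (-1) <= z 1 <= B * z (-1) &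
    [/\ forall b, 2 <= z (sg b *+ 2) <= K + 1, forall b, z (sg b *+ 3) <= K &
     `|z 0 + z 2 + z (-2) - z 1 - z (-1)| <= K]].
Proof.
have [l [wl l0]] := walk_to_origin o.
pose q x := count_mem x l.
have qs x : (q x <= size l)%N by exact: count_size.
(* The loops and the excursion contribute only 1 to the balance; the rest is five counts in [l],
   each at most [size l]. *)
exists (size l * 5).+1%:R; split; first by rewrite ler1n.
move=> A B N A0 AB N0.
have BA : 0 < B - A by rewrite subr_gt0.
(* The first term gives the target interval for the occupation number of 1 length at least 1, so
   that it contains an integer; the second makes this integer reachable by adding loops; the last
   two give the lower bounds [N]. *)
pose n := Num.bound ((B - A)^-1 + (q 1 + 3)%:R / A + N / A + N).
have nP : (B - A)^-1 + (q 1 + 3)%:R / A + N / A + N < n%:R.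
  by apply: archi_boundP; rewrite !addr_ge0// ?invr_ge0 ?divr_ge0// ltW.
have BA' : 0 < (B - A)^-1 by rewrite invr_gt0.
have qA : 0 <= (q 1 + 3)%:R / A by rewrite divr_ge0// ltW.
have NA : 0 < N / A by rewrite divr_gt0.
pose x := A * (n + q (-1) + 3)%:R.
have nn : n%:R <= (n + q (-1) + 3)%:R :> R by rewrite ler_nat -addnA leq_addr.
have x0 : 0 <= x by rewrite mulr_ge0// ltW.
have /andP[tr1 tr2] := truncn_itv x0.
have x1 : (q 1 + 3)%:R <= x.
  rewrite /x mulrC -ler_pdivrMr//; lra.
have x2 : N <= x by rewrite /x mulrC -ler_pdivrMr//; lra.
have x3 : x + 1 <= B * (n + q (-1) + 3)%:R.
  rewrite /x -lerBrDl -mulrBl -ler_pdivrMl// mulr1; lra.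
have trq : (q 1 + 3 <= (Num.truncn x).+1)%N.
  by rewrite -(ler_nat R); lra.
have [m mE] : exists m, (m + (q 1%R + 3) = (Num.truncn x).+1)%N.
  by exists ((Num.truncn x).+1 - (q 1%R + 3))%N; exact: subnK.
exists (loops 1 m (loops (-1) n (0 :: -1 :: -2 :: -1 :: 0 :: 1 :: 2 :: 1 :: l))).
set h := loops _ _ _.
have hq y : occ h y = (1 + (m * ((0%R == y) + (1%R == y)) +
    (n * ((0%R == y) + (-1%R == y)) +
      (count_mem y [:: 0; -1; -2; -1; 0; 1; 2; 1]%R + q y))))%N.
  by rewrite /occ /h !count_loops /q -count_cat.
have h1 : occ h 1 = (Num.truncn x).+1.
  by rewrite -mE hq /=; move: (q 1) => r; clear; lia.
have hm1 : occ h (-1) = (n + q (-1)%R + 3)%N.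
  by rewrite hq /=; move: (q _) => r; clear; lia.
have h0 : occ h 0 = (m + n + 3 + q 0%R)%N.
  by rewrite hq /=; move: (q _) => r; clear; lia.
have h2 : occ h 2 = (2 + q 2%R)%N by rewrite hq /=; move: (q _) => r; clear; lia.
have hm2 : occ h (-2) = (2 + q (-2)%R)%N.
  by rewrite hq /=; move: (q _) => r; clear; lia.
have h3 : occ h 3 = (1 + q 3%R)%N by rewrite hq /=; move: (q _) => r; clear; lia.
have hm3 : occ h (-3) = (1 + q (-3)%R)%N.
  by rewrite hq /=; move: (q _) => r; clear; lia.
split.
- apply: walk_loops; [by [] | exact: cur_loops |].
  apply: walk_loops; [by [] | by [] |].
  by do 8?[rewrite walk_cons//]; rewrite l0.
- by do 2 apply: cur_loops.
- split; rewrite ?h1 ?hm1 ?h0; [lra|lra|].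
  have : n%:R + 1 <= (m + n + 3 + q 0)%:R :> R.
    by rewrite natr1 ler_nat; clear; lia.
  lra.
- by rewrite h1 hm1 -/x ltW//= (le_trans _ x3)// -natr1 lerD2r.
split.
- have S y : (2 : R) <= (2 + q y)%:R <= (size l * 5).+1%:R + 1.
    rewrite natr1 !ler_nat; move: (qs y).
    by move: (q y) (size l) => r r'; clear; lia.
  by case => /=; rewrite ?h2 ?hm2; exact: S.
- have S y : (1 + q y)%:R <= (size l * 5).+1%:R :> R.
    by rewrite ler_nat; move: (qs y); move: (q y) (size l) => r r'; clear; lia.
  by case => /=; rewrite ?h3 ?hm3; exact: S.
have E : (occ h 0 + occ h 2 + occ h (-2) + (q 1%R + q (-1)%R) =
  occ h 1 + occ h (-1) + (1 + q 0%R + q 2%R + q (-2)%R))%N.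
  rewrite h0 h2 hm2 h1 hm1 -mE.
  by move: (q 0) (q 1) (q 2) (q (-1)) (q (-2)) => *; clear; lia.
have := congr1 (fun n => n%:R : R) E; rewrite !natrD.
have bq y : (q y)%:R <= (size l)%:R :> R by rewrite ler_nat qs.
have bq0 y : 0 <= (q y)%:R :> R by [].
have := (bq 0, bq 1, bq 2, bq (-1), bq (-2)).
have := (bq0 0, bq0 1, bq0 2, bq0 (-1), bq0 (-2)).
move=> [[[[a1 a2] a3] a4] a5] [[[[b1 b2] b3] b4] b5].
have -> : (size l * 5).+1%:R = (size l)%:R * 5 + 1 :> R by rewrite -natr1 natrM.
move=> *; apply/ler_normlP; split; lra.
Qed.

(** * Measurability *)

Lemma infinite_natP (A : set nat) :
  infinite_set A <-> forall N, exists n, (N <= n)%N /\ A n.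
Proof.
split=> [infA N|AN /finite_seqP[s sA]].
  apply: contrapT => /forallNP H; apply: infA; apply: (sub_finite_set (B := `I_N)).
    by move=> n An /=; rewrite ltnNge; apply/negP => Nn; exact: (H n).
  exact: finite_II.
have [n [sn]] := AN (\sum_(i <- s) i).+1; rewrite sA /= => ns.
by move: sn; rewrite (big_rem n)//= ltnNge leq_addr.
Qed.

Section Measurability.
Variables (d : measure_display) (T : measurableType d) (R : realType).
Implicit Types (u : nat -> T -> R).

Lemma measurable_forall (J : Type) (F : J -> T -> Prop) :
  countable [set: J] ->
  (forall i, measurable [set w | F i w]) -> measurable [set w | forall i, F i w].
Proof.
move=> cI mF; rewrite (_ : [set _ | _] = ~` \bigcup_i ~` [set w | F i w]).
  apply/measurableC/countable_bigcupT_measurable => // i; exact: measurableC.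
rewrite setC_bigcup; apply/seteqP; split => w /= H i; last first.
  by have := H i I; rewrite setCK.
by move=> _; rewrite setCK; exact: H.
Qed.

Lemma measurable_exists (J : Type) (F : J -> T -> Prop) :
  countable [set: J] ->
  (forall i, measurable [set w | F i w]) -> measurable [set w | exists i, F i w].
Proof.
move=> cI mF; rewrite (_ : [set _ | _] = \bigcup_i [set w | F i w]).
  exact: countable_bigcupT_measurable.
by apply/seteqP; split => w /= [i]; [exists i|move=> _; exists i].
Qed.

Lemma measurable_eventually (F : nat -> T -> Prop) :
  (forall n, measurable [set w | F n w]) ->
  measurable [set w | \forall n \near \oo, F n w].
Proof.
move=> mF; rewrite (_ : [set _ | _] =
    [set w | exists N, forall n, (N <= n)%N -> F n w]).
  apply: measurable_exists => // N; apply: measurable_forall => // n.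
  case: (leqP N n) => Nn; last first.
    by rewrite (_ : [set _ | _] = setT)//; apply/seteqP; split.
  rewrite (_ : [set _ | _] = [set w | F n w])//.
  by apply/seteqP; split => w /=; auto.
by apply/seteqP; split => w /= [N]; [move=> _ H; exists N|exists N].
Qed.

(** The hypothesis allows every [Q] because it is applied to functions of the history. *)
Lemma measurable_cvg u (l : R) :
  (forall n (Q : R -> Prop), measurable [set w | Q (u n w)]) ->
  measurable [set w | u n w @[n --> \oo] --> l].
Proof.
move=> mu; rewrite (_ : [set _ | _] =
    [set w | forall m, \forall n \near \oo, `|l - u n w| <= m.+1%:R^-1]).
  apply: measurable_forall => // m; apply: measurable_eventually => n.
  exact: (mu n (fun x => `|l - x| <= m.+1%:R^-1)).
apply/seteqP; split => w /= H; first by move=> m; move/cvgrPdist_le : H; apply.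
apply/cvgrPdist_le => e e0.
have [m _ /(_ _ (leqnn m)) me] := near_infty_natSinv_lt (PosNum e0).
by apply: filterS (H m) => n /le_trans; apply; exact: ltW.
Qed.

(** To avoid an uncountable union over limits, convergence is expressed by rational approximations,
    and membership of the limit by eventual bounds with a vanishing margin. *)
Lemma measurable_cvg_itv u (a b : R) :
  (forall n (Q : R -> Prop), measurable [set w | Q (u n w)]) ->
  measurable [set w | exists l, l \in `[a, b] /\ u n w @[n --> \oo] --> l].
Proof.
move=> mu; rewrite (_ : [set _ | _] =
    [set w | forall m : nat, (exists q : rat, \forall n \near \oo,
        `|ratr q - u n w| <= m.+1%:R^-1)] `&`
    [set w | forall m : nat, \forall n \near \oo,
        a - m.+1%:R^-1 <= u n w <= b + m.+1%:R^-1]).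
  apply: measurableI; apply: measurable_forall => // m.
    apply: measurable_exists => // q; apply: measurable_eventually => n.
    exact: (mu n (fun x => `|ratr q - x| <= m.+1%:R^-1)).
  apply: measurable_eventually => n.
  exact: (mu n (fun x => a - m.+1%:R^-1 <= x <= b + m.+1%:R^-1)).
apply/seteqP; split => w /=.
  move=> [l [+ ul]]; rewrite in_itv/= => /andP[al lb].
  split=> m; have : 0 < m.+1%:R^-1 :> R by rewrite invr_gt0.
    move: (m.+1%:R^-1 : R) => e e0; have e2 : 0 < e / 2 by rewrite divr_gt0.
    have /rat_in_itvoo[q] : l - e / 2 < l + e / 2 by lra.
    rewrite in_itv /= => /andP[q1 q2]; exists q.
    move/cvgrPdist_le : ul => /(_ _ e2); apply: filterS => n /ler_normlP[].
    by move=> *; apply/ler_normlP; split; lra.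
  move: (m.+1%:R^-1 : R) => e e0.
  move/cvgrPdist_le : ul => /(_ _ e0); apply: filterS => n /ler_normlP[].
  by move=> *; apply/andP; split; lra.
move=> [Hq Hab].
have : cvgn (u ^~ w).
  apply/cauchy_cvgP; apply: cauchy_exP => e e0.
  have [m _ /(_ _ (leqnn m)) me] := near_infty_natSinv_lt (PosNum e0).
  have [q qu] := Hq m; exists (ratr q); apply: filterS qu => n.
  by rewrite /ball /= => /le_lt_trans; apply.
move=> ul; exists (limn (u ^~ w)); split => //.
rewrite in_itv /=; apply/andP; split.
  apply/ler_addgt0Pr => e e0.
  have [m _ /(_ _ (leqnn m)) me] := near_infty_natSinv_lt (PosNum e0).
  rewrite -lerBlDr; apply: limr_ge => //; apply: filterS (Hab m) => n /andP[+ _].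
  by apply: le_trans; rewrite lerB// ltW.
apply/ler_addgt0Pr => e e0.
have [m _ /(_ _ (leqnn m)) me] := near_infty_natSinv_lt (PosNum e0).
apply: limr_le => //; apply: filterS (Hab m) => n /andP[_ /le_trans].
by apply; rewrite lerD2l ltW.
Qed.

End Measurability.

(** * Localisation *)

Lemma confining_potential (R : realType) (o : int) (a b : R) :
  0 < a -> a < b -> b < 1 ->
  exists (h0 : seq int) (good : seq int -> Prop) (pot : seq int -> R),
  [/\ walk o h0, good [::], pot [::] < 1, forall s, 0 <= pot s &
  [/\ forall y s, good s -> int_adj y (cur (s ++ h0)) ->
        pot (y :: s) < 1 -> good (y :: s),
      forall y s, good (y :: s) -> good s,
      forall s, good s -> let c := cur (s ++ h0) in
        trans R (s ++ h0) (c - 1) * pot (c - 1 :: s) +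
        trans R (s ++ h0) (c + 1) * pot (c + 1 :: s) <= pot s,
      forall s, good s -> cur (s ++ h0) \in [:: 0; 1; -1; 2; -2] &
      forall n0 (s : nat -> seq int) (y : nat -> int), s 0 = [::] ->
        (forall n, s n.+1 = y n :: s n) -> (forall n, good (s n)) ->
        let z n x : R := (occ (s n ++ h0) x)%:R in
        exists al : R, [/\ a <= al <= b,
          ln (z n 2) / ln (n0 + n)%:R @[n --> \oo] --> al,
          ln (z n (-2)) / ln (n0 + n)%:R @[n --> \oo] --> 1 - al,
          [/\ z n 1 / (n0 + n)%:R @[n --> \oo] --> al / 2,
              z n (-1) / (n0 + n)%:R @[n --> \oo] --> (1 - al) / 2 &
              z n 0 / (n0 + n)%:R @[n --> \oo] --> (1 / 2 : R)] &
          forall x, x \in [:: 0; 1; -1; 2; -2] ->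
            z n x @[n --> \oo] --> +oo]]].
Proof.
move=> a0 ab b1; have [K [K1 start]] := start_walk R o.
have a1 : a < 1 by exact: lt_trans b1.
have b0 : 0 < b by exact: lt_trans ab.
have a1' : 0 < 1 - a by rewrite subr_gt0.
have b1' : 0 < 1 - b by rewrite subr_gt0.
(* A proportion [al] at 1 corresponds to the ratio [al / (1 - al)]. *)
have [lo loE] : exists lo, lo = a / (1 - a) by exists (a / (1 - a)).
have [hi hiE] : exists hi, hi = b / (1 - b) by exists (b / (1 - b)).
have lo0 : 0 < lo by rewrite loE divr_gt0.
have hi0 : 0 < hi by rewrite hiE divr_gt0.
have lohi : lo < hi by rewrite loE hiE ltr_pdivrMr// mulrAC ltr_pdivlMr//; lra.
(* With this choice, removing a margin [eps] at both ends leaves a nontrivial interval of starting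
   ratios. *)
have [eps [eps0 epsE]] : exists eps, 0 < eps /\ 4 * eps = ln hi - ln lo.
  exists ((ln hi - ln lo) / 4); split; last by field.
  by rewrite divr_gt0// subr_gt0 ltr_ln ?posrE.
pose r0 := Num.min lo hi^-1.
have r00 : 0 < r0 by rewrite lt_min lo0 invr_gt0.
have r0_lo : r0 <= lo by rewrite ge_min lexx.
have r0_hi : r0 * hi <= 1 by rewrite -ler_pdivlMr// div1r ge_min lexx orbT.
pose w0 := 16 / eps ^+ 2.
have w00 : 0 < w0 by rewrite divr_gt0// exprn_gt0.
have w0_eps : 1 <= w0 * (eps / 4) ^+ 2.
  rewrite le_eqVlt; apply/orP; left; apply/eqP; rewrite /w0.
  by field; exact: lt0r_neq0.
pose g := r0 / 4.
have g0 : 0 < g by rewrite divr_gt0.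
(* The first term bounds [ret] by [eps / 4]; the second ensures [4 <= c2 / g]. *)
pose L := 4 / eps + r0.
have e40 : 0 < 4 / eps by rewrite divr_gt0.
have L0 : 0 < L by rewrite addr_gt0.
have L_eps : L^-1 <= eps / 4.
  by rewrite -[leRHS]invrK lef_pV2 ?posrE ?invr_gt0 ?divr_gt0// invf_div lerDl ltW.
pose c2 := L + K.
have c20 : 0 < c2 by rewrite /c2; lra.
have c2_g : 4 <= c2 / g.
  by rewrite ler_pdivlMr// /c2 /L /g; lra.
pose ct := 4 * (1 + r0^-1) ^+ 2.
have ct0 : 0 < ct by rewrite mulr_gt0// exprn_gt0// addr_gt0// invr_gt0.
(* [lam] and [M1] bring each [side] down to [1 / 4], and [M2] does so for [centre]: the initial
   potential is at most [3 / 4]. *)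
pose lam := 8 * (K + 2).
have lam0 : 0 < lam by rewrite /lam; lra.
pose M1 := 8 * (c2 / g) * (K + 1); pose M2 := 4 * ct * (w0 + 2).
have M10 : 0 < M1 by apply: mulr_gt0; [rewrite mulr_gt0 ?divr_gt0|lra].
have M20 : 0 < M2 by apply: mulr_gt0; [rewrite mulr_gt0|lra].
pose N := 3 + 4 * K + 4 / eps + M1 + M2.
have N0 : 0 < N by rewrite /N; lra.
have lohi' : lo * expR eps < hi * expR (- eps).
  have : ln (lo * expR eps) < ln (hi * expR (- eps)).
    by rewrite !lnM ?posrE ?expR_gt0// !expRK; move: epsE; lra.
  by rewrite ltr_ln ?posrE ?mulr_gt0 ?expR_gt0.
have loe : 0 < lo * expR eps by rewrite mulr_gt0// expR_gt0.
have [h0] := start _ _ _ loe lohi' N0.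
set Z := fun x => (occ h0 x)%:R : R.
move=> [wh ch [N1 Nm1 Nc] /andP[rlo rhi] [Z2 Z3 bal]].
have Z1 : 0 < Z 1 by apply: lt_le_trans N1.
have Zm1 : 0 < Z (-1) by apply: lt_le_trans Nm1.
have NZ b' : N <= Z (sg b') by case: b'.
have dN b' : dep R h0 [::] (sg b') = Z (sg b').
  by rewrite /dep /z /pos /= ch; case: b'; rewrite subr0.
have d0 : dep R h0 [::] 0 = Z 0 - 1 by rewrite /dep /z /pos /= ch eqxx.
have h_dep0 : 2 <= dep R h0 [::] 0 by rewrite d0; move: Nc; rewrite /N; lra.
have h_z2 b' : 2 <= z R h0 [::] (sg b' *+ 2) by have /andP[] := Z2 b'.
have h_dep1 b' : 1 <= dep R h0 [::] (sg b').
  by rewrite dN; have := NZ b'; rewrite /N; lra.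
have h_pos0 : pos h0 [::] = 0 by [].
have h_rlo : ln lo + eps <= ln (z R h0 [::] 1) - ln (z R h0 [::] (-1)).
  have : ln (lo * expR eps * Z (-1)) <= ln (Z 1).
    by rewrite ler_ln ?posrE ?mulr_gt0 ?expR_gt0.
  by rewrite !lnM ?posrE ?mulr_gt0 ?expR_gt0// expRK /z /= -/(Z 1) -/(Z (-1)); lra.
have h_rhi : ln (z R h0 [::] 1) - ln (z R h0 [::] (-1)) <= ln hi - eps.
  have : ln (Z 1) <= ln (hi * expR (- eps) * Z (-1)).
    by rewrite ler_ln ?posrE ?mulr_gt0 ?expR_gt0.
  by rewrite !lnM ?posrE ?mulr_gt0 ?expR_gt0// expRK /z /= -/(Z 1) -/(Z (-1)); lra.
have h_z1 b' : (z R h0 [::] (sg b'))^-1 <= eps / 4.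
  rewrite -[leRHS]invrK lef_pV2 ?posrE ?invr_gt0 ?divr_gt0 ?z_gt0// invf_div.
  by have := NZ b'; rewrite /N -/(Z (sg b')); lra.
have h_dK b' : 4 * K <= dep R h0 [::] (sg b').
  by rewrite dN; have := NZ b'; rewrite /N; lra.
have h_c : L + K <= c2 by [].
have h_side b' : side h0 lam L g c2 b' [::] <= 1 / 4.
  have /andP[z2l z2u] := Z2 b'; have := NZ b'.
  rewrite /side /= !oppr0 expR0 mulr1 mulr0 add0r dN h_pos0 -/(z R h0 [::] _).
  have -> : (0 == sg b' *+ 2) = false by case: (b').
  rewrite mulr0 addr0 -/(Z (sg b' *+ 2)) => NZb.
  have Zb : 0 < Z (sg b') by apply: lt_le_trans NZb.
  have t1 : Z (sg b' *+ 2) / lam + 1 / (Z (sg b' *+ 2) - 1) / lam <= 1 / 8.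
    rewrite -mulrDl ler_pdivrMr// /lam.
    have : 1 / (Z (sg b' *+ 2) - 1) <= 1.
      by rewrite ler_pdivrMr; move: z2l; rewrite -/(Z _); lra.
    by move: (1 / (_ - 1)) z2u => e; rewrite -/(Z _); lra.
  have t2 : c2 / g * Z (sg b' *+ 2) / Z (sg b') <= 1 / 8.
    rewrite ler_pdivrMr//.
    have : c2 / g * Z (sg b' *+ 2) <= c2 / g * (K + 1).
      by rewrite ler_wpM2l// divr_ge0// ltW.
    have : M1 <= Z (sg b') by apply: le_trans NZb; rewrite /N; lra.
    by rewrite /M1; lra.
  by lra.
have h_centre : centre h0 w0 ct [::] <= 1 / 4.
  rewrite /centre /= expr0n mulr0 add0r d0.
  have : N <= Z 0 - 1 by [].
  move=> NZ0; rewrite ler_pdivrMr; last by rewrite /N in NZ0; lra.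
  have : M2 <= Z 0 - 1 - 1 by apply: le_trans (lerB NZ0 (lexx 1)); rewrite /N; lra.
  by rewrite /M2; lra.
have h_pot : pot h0 w0 lam L g c2 ct [::] < 1.
  rewrite /pot h_pos0 normr0 addr0.
  by have := h_side true; have := h_side false; lra.
exists h0, (good h0 w0 lam L g c2 ct), (pot h0 w0 lam L g c2 ct); split => //.
- exact: pot_ge0.
split.
- by move=> y s gs /int_adjP ys ps; split=> //; case: ys => ->; rewrite eqxx ?orbT.
- by move=> y s [].
- move=> s gs; exact: (mean_pot_le h_dep0 w00 lam0 L0 g0 ct0 c20 h_z2 h_dep1 h_c
    h_pos0 lo0 hi0 eps0 r00 r0_lo r0_hi h_rlo h_rhi w0_eps L_eps h_z1 erefl c2_g
    (lexx ct) Z3 bal h_dK gs).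
- move=> s gs.
  exact: (good_pos h_dep0 w00 lam0 L0 g0 ct0 c20 h_z2 h_dep1 h_pos0 gs).
move=> n0 s y s0 sS gs.
have [al [/andP[al1 al2] *]] := good_trajectory h_dep0 w00 lam0 L0 g0 ct0 c20
  h_z2 h_dep1 h_pos0 lo0 hi0 eps0 r00 r0_lo r0_hi h_rlo h_rhi w0_eps L_eps h_z1
  erefl c2_g
  Z3 bal h_dK n0 s0 sS gs.
exists al; split=> //; apply/andP; split.
  apply: le_trans al1; rewrite loE le_eqVlt; apply/orP; left; apply/eqP.
  by field; rewrite !lt0r_neq0//; lra.
apply: (le_trans al2); rewrite hiE le_eqVlt; apply/orP; left; apply/eqP.
by field; rewrite !lt0r_neq0//; lra.
Qed.

(** * Measurability of the localisation event *)

Section Event.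
Variables (d : measure_display) (T : measurableType d) (R : realType).
Variables (P : probability T R) (X : nat -> {RV P >-> int}) (k : int).

Let Z n x w : R := (occupation (fun i => X i) n x w)%:R.

Let measurable_Z n (x : int) (Q : R -> Prop) (f : R -> R) :
  measurable [set w | Q (f (Z n x w))].
Proof.
rewrite (_ : [set _ | _] =
    [set w | Q (f ((occ (hist X k n w) (x - k))%:R))]).
  exact: (measurable_hist X k n (fun h => Q (f (occ h (x - k))%:R))).
by apply/seteqP; split => w /=; rewrite /Z (occupation_hist X k).
Qed.

Let measurable_Z2 n (x y : int) (Q : R -> Prop) (f : R -> R -> R) :
  measurable [set w | Q (f (Z n x w) (Z n y w))].
Proof.
rewrite (_ : [set _ | _] = [set w | Q (f (occ (hist X k n w) (x - k))%:R
   (occ (hist X k n w) (y - k))%:R)]).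
  exact: (measurable_hist X k n (fun h =>
    Q (f (occ h (x - k))%:R (occ h (y - k))%:R))).
by apply/seteqP; split => w /=; rewrite /Z !(occupation_hist X k).
Qed.

Lemma measurable_infinitely_visited (S : set int) :
  measurable [set w | infinitely_visited (fun i => X i) w = S].
Proof.
rewrite (_ : [set _ | _] = [set w | forall j : int,
    (forall N, exists n, (N <= n)%N /\ X n w = j) <-> S j]).
  apply: measurable_forall; first exact: countableP.
  move=> j.
  pose io := [set w | forall N, exists n, (N <= n)%N /\ X n w = j].
  have mj : measurable io.
    apply: measurable_forall => // N; apply: measurable_exists => // n.
    case: (leqP N n) => Nn; last first.
      by rewrite (_ : [set _ | _] = set0)//; apply/seteqP; split => w // [].
    rewrite (_ : [set _ | _] = X n @^-1` [set j]); first exact: measurable_X.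
    by apply/seteqP; split => w /=; [case|].
  have [Sj|Sj] := pselect (S j).
    rewrite (_ : [set _ | _] = io)//.
    by apply/seteqP; split => w /=; [case=> _; exact|].
  rewrite (_ : [set _ | _] = ~` io).
    exact: measurableC.
  by apply/seteqP; split => w /=; [move=> [H _] /H|move=> H; split].
apply/seteqP; split => w /= H.
  by move=> j; rewrite -H /infinitely_visited /=; split => /infinite_natP.
by apply/seteqP; split => j /=; rewrite -H => /infinite_natP.
Qed.

(** As [alpha] is the limit of [u], adding or subtracting multiples of [u] in the other limits
    eliminates it. *)
Lemma measurable_localisation (a b : R) (S : set int) :
  measurable [set w | exists alpha : R, alpha \in `[a, b] /\
    [/\ infinitely_visited (fun i => X i) w = S,
        ln (Z n (k + 2) w) / ln n%:R @[n --> \oo] --> alpha,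
        ln (Z n (k - 2) w) / ln n%:R @[n --> \oo] --> 1 - alpha &
    [/\ Z n (k + 1) w / n%:R @[n --> \oo] --> alpha / 2,
        Z n (k - 1) w / n%:R @[n --> \oo] --> (1 - alpha) / 2 &
        Z n k w / n%:R @[n --> \oo] --> (1 / 2 : R)]]].
Proof.
pose u n w := ln (Z n (k + 2) w) / ln n%:R.
pose v n w := ln (Z n (k - 2) w) / ln n%:R.
rewrite (_ : [set _ | _] =
  [set w | infinitely_visited (fun i => X i) w = S] `&`
  [set w | exists l, l \in `[a, b] /\ u n w @[n --> \oo] --> l] `&`
  [set w | v n w + u n w @[n --> \oo] --> (1 : R)] `&`
  [set w | Z n (k + 1) w / n%:R - u n w / 2 @[n --> \oo] --> (0 : R)] `&`
  [set w | Z n (k - 1) w / n%:R + u n w / 2 @[n --> \oo] --> (1 / 2 : R)] `&`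
  [set w | Z n k w / n%:R @[n --> \oo] --> (1 / 2 : R)]).
  do !apply: measurableI.
  - exact: measurable_infinitely_visited.
  - apply: measurable_cvg_itv => n Q.
    exact: (@measurable_Z n (k + 2) Q (fun x => ln x / ln n%:R)).
  - apply: measurable_cvg => n Q.
    exact: (@measurable_Z2 n (k - 2) (k + 2) Q
      (fun x y => ln x / ln n%:R + ln y / ln n%:R)).
  - apply: measurable_cvg => n Q.
    exact: (@measurable_Z2 n (k + 1) (k + 2) Q
      (fun x y => x / n%:R - ln y / ln n%:R / 2)).
  - apply: measurable_cvg => n Q.
    exact: (@measurable_Z2 n (k - 1) (k + 2) Q
      (fun x y => x / n%:R + ln y / ln n%:R / 2)).
  - apply: measurable_cvg => n Q.
    exact: (@measurable_Z n k Q (fun x => x / n%:R)).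
apply/seteqP; split => w /=.
  move=> [al [alab [infS ul vl [pl ql rl]]]].
  have ul2 : u n w / 2 @[n --> \oo] --> al / 2 by apply: cvgM => //; exact: cvg_cst.
  split=> //; split; [split; [split; [split => //|]|]|].
  - by exists al.
  - rewrite (_ : 1 = 1 - al + al); last by rewrite subrK.
    exact: cvgD.
  - by rewrite -(subrr (al / 2)); exact: cvgB.
  - by rewrite (_ : 1 / 2 = (1 - al) / 2 + al / 2); [exact: cvgD|field].
move=> [[[[[infS [al [alab ul]]] vu] pu] qu] rl].
have ul2 : u n w / 2 @[n --> \oo] --> al / 2 by apply: cvgM => //; exact: cvg_cst.
exists al; split=> //; split => //.
- have H : v n w + u n w - u n w @[n --> \oo] --> 1 - al by exact: cvgB.
  by apply: eq_near_cvg H; apply: nearW => n; rewrite addrK.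
split=> //.
- have H : Z n (k + 1) w / n%:R - u n w / 2 + u n w / 2 @[n --> \oo] --> 0 + al / 2.
    exact: cvgD.
  by rewrite add0r in H; apply: eq_near_cvg H; apply: nearW => n; rewrite subrK.
have H : Z n (k - 1) w / n%:R + u n w / 2 - u n w / 2 @[n --> \oo] -->
    1 / 2 - al / 2.
  exact: cvgB.
rewrite mulrBl; apply: eq_near_cvg H.
by apply: nearW => n; rewrite addrK.
Qed.

End Event.

(** * Localisation around an arbitrary vertex with positive probability *)

Lemma limit_shift (R : realType) (n0 : nat) (u w : R^nat) (l : R) :
  (forall n, u (n0 + n)%N = w n) -> w n @[n --> \oo] --> l ->
  u n @[n --> \oo] --> l.
Proof.
move=> uw wl; rewrite -(cvg_shiftn n0); apply: eq_near_cvg wl.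
by apply: nearW => n; rewrite /= addnC uw.
Qed.

Lemma window_mem (k j : int) :
  [set k - 2; k - 1; k; k + 1; k + 2] j <-> j - k \in [:: 0; 1; -1; 2; -2].
Proof. by rewrite /= !inE; lia. Qed.

Theorem theorem1p3 (d : measure_display) (T : measurableType d)
    (R : realType) (P : probability T R) (v : int)
    (X : nat -> {RV P >-> int}) (hX : is_vrrw v X)
    (a b : R) (ha : 0 < a) (hab : a < b) (hb : b < 1) (k : int) :
  let Z n x w : R := (occupation X n x w)%:R in
  let E := [set w | exists alpha : R, alpha \in `[a, b] /\
    [/\ infinitely_visited X w = [set k - 2; k - 1; k; k + 1; k + 2],
        ln (Z n (k + 2) w) / ln n%:R @[n --> \oo] --> alpha,
        ln (Z n (k - 2) w) / ln n%:R @[n --> \oo] --> 1 - alpha &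
    [/\ Z n (k + 1) w / n%:R @[n --> \oo] --> alpha / 2,
        Z n (k - 1) w / n%:R @[n --> \oo] --> (1 - alpha) / 2 &
        Z n k w / n%:R @[n --> \oo] --> (1 / 2 : R)]]] in
  measurable E /\ (0 < P E)%E.
Proof.
move=> Z E.
have mE : measurable E by exact: measurable_localisation.
split=> //.
have [h0 [good [pot [wh0 good0 pot0 pot_pos]]]] :=
  confining_potential (v - k) ha hab hb.
move=> [good_cons good_behead mean good_cur traj].
have [n0 sh0] : exists n0, size h0 = n0.+1.
  case: h0 wh0 {good0 good_cons mean good_cur traj} => // x h _.
  by exists (size h).
have := good_forever k hX sh0 pot_pos good_cons good_behead mean good0.
set W := [set w | forall r, _] => lbW.
have : (0 < P W)%E.
  apply: lt_le_trans lbW; rewrite mule_gt0 ?lte_fin ?subr_gt0//.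
  by have := hist_gt0 hX wh0 sh0.
have mW : measurable W.
  apply: measurable_forall => // r.
  exact: (measurable_hist X k (n0 + r) (fun h => exists s,
    [/\ size s = r, h = s ++ h0 & good s])).
move/lt_le_trans; apply; apply: le_measure; rewrite ?inE//.
(* Most recent first, the positions visited after [h0] are the first [r] entries. *)
move=> w Ww; pose s r := take r (hist X k (n0 + r) w).
have sP r : hist X k (n0 + r) w = s r ++ h0 /\ good (s r).
  have [s' [<- hs gs]] := Ww r; rewrite /s.
  by rewrite hs take_size_cat.
have s0 : s 0 = [::] by rewrite /s take0.
have sS r : s r.+1 = (X (n0 + r).+1 w - k) :: s r by rewrite /s addnS.
have [al [alab lnp lnm [zp zm z0] zoo]] := traj n0 s _ s0 sS (fun n => (sP n).2).
have ZE n x : Z (n0 + n)%N x w = (occ (s n ++ h0) (x - k))%:R.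
  by rewrite /Z (occupation_hist X k) (sP n).1.
have kK (x : int) : k + x - k = x by rewrite addrAC subrr add0r.
exists al; split; first by rewrite in_itv.
split.
- apply/seteqP; split => j.
    move=> /infinite_natP/(_ n0)[n [n0n Xn]]; apply/window_mem.
    have [hn gn] := sP (n - n0)%N; have := good_cur _ gn.
    by rewrite -hn subnKC// cur_hist Xn.
  (* Without a visit to [j] from time [N] on, its occupation number would freeze, although it
     diverges. *)
  move=> /window_mem jk; apply/infinite_natP => N; apply: contrapT => /forallNP noN.
  have const m : occ (s (N + m)%N ++ h0) (j - k) = occ (s N ++ h0) (j - k).
    elim: m => [|m IH]; first by rewrite addn0.
    rewrite addnS sS -IH /occ /= addnA [(1 + _ + _)%N]addnAC.
    case: eqP => [Xj|_]; last by rewrite addn0.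
    case: (noN (n0 + (N + m)).+1); split; last exact: addIr Xj.
    by rewrite (leq_trans (leq_addr m N))// -addnS (leq_trans _ (leq_addl _ _)).
  have := zoo _ jk => /cvgryPge/(_ ((occ (s N ++ h0) (j - k))%:R + 1))[M _ HM].
  have := HM (N + M)%N (leq_addl _ _); rewrite /= const.
  by rewrite gerDl leNgt ltr01.
- by apply: (limit_shift (n0 := n0)) lnp => n; rewrite /= ZE kK.
- by apply: (limit_shift (n0 := n0)) lnm => n; rewrite /= ZE kK.
split.
- by apply: (limit_shift (n0 := n0)) zp => n; rewrite /= ZE kK.
- by apply: (limit_shift (n0 := n0)) zm => n; rewrite /= ZE kK.
- by apply: (limit_shift (n0 := n0)) z0 => n; rewrite /= ZE subrr.
Qed.
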